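(* Let $d\ge 1$, let $(\xi(z)\colon z\in\mathbb{Z}^d)$ be independent with $P(\xi(z)>x)=e^{-x}$ for $x\ge 0$, let $u$ be the unique nonnegative solution of the parabolic Anderson model with potential $\xi$ and initial condition $\mathbf 1_{0}$, let $U(t)=\sum_{z\in\mathbb{Z}^d}u(t,z)$ and $L_t=\frac1t\log U(t)$. Then, almost surely, $$\limsup_{t\uparrow\infty}\frac{L_t-d\log t}{\log\log t}=1$$ and $$\liminf_{t\uparrow\infty}\frac{L_t-d\log t}{\log\log\log t}=-(d+1).$$
   Context: The parabolic Anderson model with time-constant potential $\xi$ is the Cauchy problem $$\partial_t u(t,z)=\Delta u(t,z)+\xi(z)u(t,z)\ \text{ for }(t,z)\in(0,\infty)\times\mathbb{Z}^d,\qquad \lim_{t\downarrow0}u(t,z)=\mathbf 1_{0}(z)\ \text{ for } z\in\mathbb{Z}^d,$$ where $(\Delta f)(z)=\sum_{y\sim z}[f(y)-f(z)]$ is the (unnormalised) discrete Laplacian, the sum being over the $2d$ nearest neighbours of $z$. Its unique nonnegative solution is, almost surely, given by the Feynman-Kac formula $u(t,z)=\mathbb{E}\big[\exp\{\int_0^t\xi(X_s)\,ds\}\mathbf 1\{X_t=z\}\big]$, where $(X_s)_{s\ge0}$ is the continuous-time simple random walk on $\mathbb{Z}^d$ started at the origin with generator $\Delta$, and $\mathbb{E}$ is expectation over the walk only (for fixed $\xi$). *)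

(* Defs.v *)
From HB Require Import structures.
From mathcomp Require Import all_boot all_order all_algebra finmap.
From mathcomp Require Import all_classical all_reals all_analysis.

Set Implicit Arguments.
Unset Strict Implicit.
Unset Printing Implicit Defensive.

Import Order.TTheory GRing.Theory Num.Theory.
Import numFieldNormedType.Exports.

Local Open Scope classical_set_scope.
Local Open Scope ring_scope.

Definition mutually_independent d (T : measurableType d) (R : realType)
    (P : probability T R) (I : choiceType) (X : I -> {RV P >-> R}) : Prop :=
  forall (J : {fset I}) (B : I -> set R),
    (forall i, i \in J -> measurable (B i)) ->
    P (\bigcap_(i in [set` J]) (X i @^-1` B i)) =
      (\prod_(i <- J) P (X i @^-1` B i))%E.

Definition standard_exponential d (T : measurableType d) (R : realType)
    (P : probability T R) (X : {RV P >-> R}) : Prop :=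
  forall x : R, 0 <= x -> P [set w | x < X w] = (expR (- x))%:E.

Section parabolic_anderson.
Context {R : realType} {d : nat}.

(* The lattice Z^d is 'rV[int]_d. *)
Definition unit_vector (i : 'I_d) : 'rV[int]_d := delta_mx 0 i.

(* The nearest neighbours of z are the 2d points z + e_i and z - e_i. *)
Definition lattice_laplacian (f : 'rV[int]_d -> R) (z : 'rV[int]_d) : R :=
  \sum_(i < d) ((f (z + unit_vector i) - f z) + (f (z - unit_vector i) - f z)).

(* Only the values of u at times t > 0 are constrained. *)
Definition nonneg_pam_solution (xi : 'rV[int]_d -> R)
    (u : R -> 'rV[int]_d -> R) : Prop :=
  [/\ forall (t : R) z, 0 < t -> 0 <= u t z,
      forall (t : R) z, 0 < t ->
        is_derive t 1 (u ^~ z) (lattice_laplacian (u t) z + xi z * u t z)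
    & forall z, u t z @[t --> 0^'+] --> ((z == 0)%:R : R) ].

(* The total mass is an unordered sum of nonnegative terms in [0, +oo]; lne is
   the logarithm on the extended reals, so no finiteness is presupposed. *)
Definition total_mass (u : R -> 'rV[int]_d -> R) (t : R) : \bar R :=
  \esum_(z in [set: 'rV[int]_d]) (u t z)%:E.

Definition growth_rate (u : R -> 'rV[int]_d -> R) (t : R) : \bar R :=
  ((t^-1)%:E * lne (total_mass u t))%E.

End parabolic_anderson.

(* Main.v *)
Require Import Defs.
From HB Require Import structures.
From mathcomp Require Import all_boot all_order all_algebra finmap.
From mathcomp Require Import all_classical all_reals all_analysis measurable_realfun.
From mathcomp Require Import zify ring lra.

(** Writing |z| for the l^1 norm, errors of order t in log U(t) are harmless, so
    only high sites and the cost of reaching them matter.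

    Lower bound: the equation gives u(s + r, z) >= e^(-2dr) r^n / n! u(s, y) with
    n = |z - y|, so running to z in time t / log t and staying there yields
    L_t >= (1 - 1 / log t) xi(z) - 4d as soon as |z| loglog t <= 2dt.

    Upper bound: if S is nondecreasing with S(0) = 0 and
    xi(z) + 2d (e^(S(|z|) - S(|z| - 1)) - 1) <= lam + S(|z|) / 2t for all z, then
    exp(lam s - S(|z|) (1 - s / 2t)) is a supersolution on [0, t], whence
    u(t, z) <= exp(lam t - S(|z|) / 2).  With S(r) = r this gives the upper bound
    for the limsup.  For the liminf, S increases by log k (t = 2^(k^2)) on each
    sphere without a very high site and is constant on the others; these are so
    few that S(r) / 2t is of order (r / t) loglog t, the true cost of leaving the
    ball of radius t / loglog t.

    Probability: Borel-Cantelli on dyadic scales, along t = 2^(k^2) and disjoint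
    annuli for the liminf.  Each threshold is tuned so that the k-th event has
    probability about 1 / k or 1 / k^2. *)

Set Implicit Arguments.
Unset Strict Implicit.
Unset Printing Implicit Defensive.

Import Order.TTheory GRing.Theory Num.Theory.
Import numFieldNormedType.Exports.

Local Open Scope classical_set_scope.
Local Open Scope ring_scope.

(** * One-variable calculus *)

Section calculus.
Context {R : realType}.
Implicit Types (f df : R -> R) (a b x : R).

(** The constant in the liminf arises as d + 1: reachable sites lie within about t / loglog t, which
    costs d logloglog t against the typical maximum d log t of the field in the ball of radius t; an
    untypically low maximum costs one more logloglog t, since it falls short by log log k with
    probability about a power of 1 / k. Along t = 2^(k^2), logloglog t is log log k up to a bounded
    amount, so thinning the times is free. Sites closer than t 2^-k are too low by about d k log 2,
    sites beyond t 2^k are too far, and the annuli in between are disjoint, hence independent. The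
    obstacle in the upper bound is that an increment log k of S costs 2d(k - 1) in the condition on
    lam, while only O(1) is allowed. This is affordable at sites below (d - 1/2) log t, where the
    slack is of order k^2, and beyond t 2^k; elsewhere S has to be flat. High sites number at most t
    2^-k, so flattening S on their spheres changes S(r) / 2t by at most 1. *)

Lemma is_derive_ndecr f df a b : a <= b ->
  (forall x, a <= x <= b -> is_derive x (1 : R) f (df x)) ->
  (forall x, a <= x <= b -> 0 <= df x) -> f a <= f b.
Proof.
move=> ab dfE df0.
apply: (@ger0_derive1_ndecr R f a b) => // [x xab|x xab|].
- by have [] := dfE x (subset_itv_oo_cc xab).
- have xab' := subset_itv_oo_cc xab.
  by rewrite derive1E (@derive_val _ _ _ _ _ _ _ (dfE x xab')) df0.
- apply: derivable_within_continuous => x xab.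
  by have [] := dfE x xab.
Qed.

(** A criterion suited to functions defined by cases: it makes the squared negative part
    differentiable at its kink as well. *)
Lemma is_derive_quadratic f x l (C : R) :
  (forall h, `|f (x + h) - f x - h * l| <= C * h ^+ 2) -> is_derive x 1 f l.
Proof.
move=> fC.
have key : (fun h => h^-1 *: ((f \o shift x) (h *: (1 : R)) - f x)) @ 0^' --> l.
  apply/cvgrPdist_le => e e0.
  have C1 : 0 < `|C| + 1 by rewrite ltr_wpDl.
  near=> h.
  have h0 : h != 0 by near: h; exact: nbhs_dnbhs_neq.
  rewrite /= /GRing.scale/= mulr1 (addrC h).
  have -> : l - h^-1 * (f (x + h) - f x) = - (h^-1 * (f (x + h) - f x - h * l)).
    by field.
  rewrite normrN normrM normfV ler_pdivrMl ?normr_gt0// (le_trans (fC h))//.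
  have he : (`|C| + 1) * `|h| <= e.
    rewrite -ler_pdivlMl// mulrC.
    near: h; apply: dnbhs0_le.
    by rewrite divr_gt0.
  rewrite -real_normK ?num_real// expr2 mulrA mulrC ler_wpM2l//.
  apply: le_trans he; rewrite ler_wpM2r//.
  by rewrite (le_trans (ler_norm _))// lerDl.
by split; [apply/cvg_ex; exists l|apply/cvg_lim].
Unshelve. all: by end_near. Qed.

Lemma is_derive_sqr_minr0 x :
  is_derive x 1 (fun y : R => (Num.min y 0) ^+ 2) (2 * Num.min x 0).
Proof.
apply: (@is_derive_quadratic _ _ _ 1) => h.
by rewrite ler_norml /Num.min; do 2 case: ifPn; rewrite -?leNgt; nra.
Qed.

Lemma is_derive_exprn n x :
  is_derive x 1 (fun y : R => y ^+ n) (n%:R * x ^+ n.-1).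
Proof.
have := @is_deriveX R R (@id R) n x 1 1 (is_derive_id _ _).
by rewrite exprfctE /GRing.scale/= mulr1.
Qed.

Lemma is_derive_continuous f x l : is_derive x 1 f l ->
  f y @[y --> x] --> f x.
Proof. by move=> [/derivable1_diffP/differentiable_continuous]. Qed.

Lemma is_derive_cvg_right f x l : is_derive x 1 f l ->
  f y @[y --> x^'+] --> f x.
Proof. by move=> /is_derive_continuous; exact: cvg_at_right_filter. Qed.

End calculus.

(** * Lower bounds for nonnegative solutions *)

Section lattice.
Context {d : nat}.
Implicit Types (z y : 'rV[int]_d) (i : 'I_d).

Definition norm1 z : nat := \sum_(i < d) `|z 0%R i|%N.

Lemma norm1_0 : norm1 0 = 0%N.
Proof. by rewrite /norm1 big1// => i _; rewrite mxE. Qed.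

Lemma norm1_eq0 z : (norm1 z == 0%N) = (z == 0).
Proof.
apply/idP/eqP => [|->]; last by rewrite norm1_0.
rewrite sum_nat_eq0 => /forallP z0; apply/rowP => i; rewrite mxE.
by have := z0 i; rewrite /= absz_eq0 => /eqP.
Qed.

Lemma norm1_shift z i (e : int) :
  norm1 (z + e *: unit_vector i) =
  (absz (z 0 i + e)%R + \sum_(j < d | j != i) absz (z 0 j)%R)%N.
Proof.
rewrite /norm1 /unit_vector (bigD1 i)//= !mxE !eqxx mulr1; congr (_ + _)%N.
by apply: eq_bigr => j ji; rewrite !mxE (negbTE ji) andbF mulr0 addr0.
Qed.

Lemma norm1D1 z i :
  norm1 z = (absz (z 0 i)%R + \sum_(j < d | j != i) absz (z 0 j)%R)%N.
Proof. by rewrite /norm1 (bigD1 i). Qed.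

(** A lattice step never preserves the l^1 norm, so a radial function at z interacts only with its
    values at radii |z| - 1 and |z| + 1. *)
Lemma norm1_add z i :
  norm1 (z + unit_vector i) = (norm1 z).+1 \/
  norm1 z = (norm1 (z + unit_vector i)).+1.
Proof.
have := norm1_shift z i 1; rewrite scale1r => ->; rewrite (norm1D1 z i); lia.
Qed.

Lemma norm1_sub z i :
  norm1 (z - unit_vector i) = (norm1 z).+1 \/
  norm1 z = (norm1 (z - unit_vector i)).+1.
Proof.
have := norm1_shift z i (-1); rewrite scaleN1r => ->; rewrite (norm1D1 z i); lia.
Qed.

Lemma norm1_step z n : norm1 z = n.+1 ->
  exists i, norm1 (z + unit_vector i) = n \/ norm1 (z - unit_vector i) = n.
Proof.
move=> zn; have [i zi] : exists i, z 0 i != 0.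
  apply/existsP; apply: contraT; rewrite negb_exists => /forallP z0.
  have : z = 0 by apply/rowP => i; rewrite mxE; apply/eqP; rewrite -[_ == _]negbK.
  by move=> /eqP; rewrite -norm1_eq0 zn.
exists i; have := norm1_shift z i 1; have := norm1_shift z i (-1).
rewrite scale1r scaleN1r => -> ->; move: zn zi; rewrite (norm1D1 z i); lia.
Qed.

End lattice.

Section laplacian.
Context {R : realType} {d : nat}.
Implicit Types (f g : 'rV[int]_d -> R) (z : 'rV[int]_d).

Definition neighbour_sum f z : R :=
  \sum_(i < d) (f (z + unit_vector i) + f (z - unit_vector i)).

Lemma lattice_laplacianE f z :
  lattice_laplacian f z = neighbour_sum f z - 2 * d%:R * f z.
Proof.
rewrite /lattice_laplacian /neighbour_sum.
rewrite (eq_bigr (fun i => (f (z + unit_vector i) + f (z - unit_vector i)) +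
   (- (2 * f z)))) => [|i _]; last by ring.
rewrite big_split/= sumr_const card_ord -mulr_natr; ring.
Qed.

Lemma neighbour_sum_ge0 f z : (forall y, 0 <= f y) -> 0 <= neighbour_sum f z.
Proof. by move=> f0; apply: sumr_ge0 => i _; rewrite addr_ge0. Qed.

Lemma neighbour_sum_ge_add f z i : (forall y, 0 <= f y) ->
  f (z + unit_vector i) <= neighbour_sum f z.
Proof.
move=> f0; rewrite /neighbour_sum (bigD1 i)//= -addrA lerDl addr_ge0//.
by apply: sumr_ge0 => j _; rewrite addr_ge0.
Qed.

Lemma neighbour_sum_ge_sub f z i : (forall y, 0 <= f y) ->
  f (z - unit_vector i) <= neighbour_sum f z.
Proof.
move=> f0; rewrite /neighbour_sum (bigD1 i)//= addrAC lerDr addr_ge0//.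
by apply: sumr_ge0 => j _; rewrite addr_ge0.
Qed.

Lemma le_neighbour_sum f z (C : R) :
  (forall i, f (z + unit_vector i) <= C) ->
  (forall i, f (z - unit_vector i) <= C) -> neighbour_sum f z <= 2 * d%:R * C.
Proof.
move=> fa fs; apply: (@le_trans _ _ (\sum_(i < d) (2 * C))).
  by apply: ler_sum => i _; rewrite mulr_natl mulr2n lerD.
rewrite sumr_const card_ord -mulr_natr; lra.
Qed.

End laplacian.

Section solution_lower_bounds.
Context {R : realType} {d : nat}.
Variables (xi : 'rV[int]_d -> R) (u : R -> 'rV[int]_d -> R).
Hypothesis xi0 : forall z, 0 <= xi z.
Hypothesis solu : nonneg_pam_solution xi u.
Implicit Types (z y : 'rV[int]_d) (s t : R).

Let u_ge0 t z : 0 < t -> 0 <= u t z.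
Proof. by move=> t0; have [h _ _] := solu; exact: h. Qed.

Let is_derive_u s t z : 0 < s -> 0 <= t ->
  is_derive t 1 (fun r => u (s + r) z)
    (neighbour_sum (u (s + t)) z - 2 * d%:R * u (s + t) z + xi z * u (s + t) z).
Proof.
move=> s0 t0; have [_ h _] := solu.
have st0 : 0 < s + t by rewrite ltr_wpDr.
have H := h (s + t) z st0; rewrite -lattice_laplacianE.
have sh : is_derive t (1 : R) (fun r : R => s + r) 1.
  have -> : (fun r : R => s + r) = shift s by apply/funext => r; rewrite addrC.
  exact: is_derive_shift.
by rewrite -[X in is_derive _ _ _ X]mulr1; exact: (@is_derive1_comp R (u^~ z)).
Qed.

(** Induction on the distance: in the equation for e^(2dr) u(s + r, z) only one neighbour closer to
    [y] is kept, and the induction bound r^m / m! is integrated in time. The starting time [s] is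
    positive because the equation holds only there. *)
Lemma pam_path_le s t z y : 0 < s -> 0 <= t ->
  expR (- (2 * d%:R * t)) * (t ^+ norm1 (z - y) / (norm1 (z - y))`!%:R) * u s y
  <= u (s + t) z.
Proof.
move=> s0; have [n] := ubnP (norm1 (z - y)).
have [m mE] : exists m, m = norm1 (z - y) by eexists.
rewrite -mE => _; elim: m z t mE => [|m IH] z t mE t0.
  have -> : z = y.
    by apply/eqP; rewrite -subr_eq0 -norm1_eq0 -mE.
  rewrite expr0 fact0 divr1 mulr1.
  rewrite expRN ler_pdivrMl ?expR_gt0//.
  pose f r := expR (2 * d%:R * r) * u (s + r) y.
  have : f 0 <= f t.
    pose df : R -> R := fun r => expR (2 * d%:R * r) *
      (neighbour_sum (u (s + r)) y + xi y * u (s + r) y).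
    have fdf r : 0 <= r <= t -> is_derive r 1 f (df r).
      move=> /andP[r0 rt].
      have := is_derive_u y s0 r0 => H; apply: is_derive_eq.
      rewrite /df /GRing.scale/=; ring.
    apply: (is_derive_ndecr t0 fdf) => r /andP[r0 rt]; rewrite /df.
    have sr0 : 0 < s + r by rewrite ltr_wpDr.
    rewrite mulr_ge0 ?expR_ge0// addr_ge0 ?mulr_ge0 ?u_ge0//.
    by apply: neighbour_sum_ge0 => x; exact: u_ge0.
  by rewrite /f mulr0 expR0 mul1r addr0.
(* The subtracted term is the integral of r^m / m! times u(s, y), the contribution of the chosen
   neighbour. *)
pose f r := expR (2 * d%:R * r) * u (s + r) z - u s y / (m.+1)`!%:R * r ^+ m.+1.
have : f 0 <= f t.
  pose df : R -> R := fun r => expR (2 * d%:R * r) *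
      (neighbour_sum (u (s + r)) z + xi z * u (s + r) z)
       - r ^+ m / m`!%:R * u s y.
  have fdf r : 0 <= r <= t -> is_derive r 1 f (df r).
    move=> /andP[r0 rt].
    have H := is_derive_u z s0 r0; have X := is_derive_exprn m.+1 r.
    apply: is_derive_eq; rewrite /df /GRing.scale/= factS natrM.
    have m0 : m`!%:R != 0 :> R by rewrite pnatr_eq0 -lt0n fact_gt0.
    have m1 : 1 + m%:R != 0 :> R by rewrite nat1r.
    by field; rewrite m0 m1.
  apply: (is_derive_ndecr t0 fdf) => r /andP[r0 rt]; rewrite /df.
  have sr0 : 0 < s + r by rewrite ltr_wpDr.
  have ur x : 0 <= u (s + r) x by exact: u_ge0.
  rewrite subr_ge0.
  have nb : exists2 x, norm1 (x - y) = m & u (s + r) x <= neighbour_sum (u (s + r)) z.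
    have [i [h|h]] := norm1_step (esym mE).
    - exists (z + unit_vector i); first by rewrite addrAC.
      exact: neighbour_sum_ge_add.
    - exists (z - unit_vector i); first by rewrite addrAC.
      exact: neighbour_sum_ge_sub.
  have [x xm xle] := nb.
  have := IH x r (esym xm) r0; rewrite expRN -!mulrA ler_pdivrMl ?expR_gt0// mulrA => /le_trans; apply.
  rewrite ler_wpM2l ?expR_ge0// (le_trans xle)// lerDl mulr_ge0//.
rewrite /f mulr0 expR0 mul1r addr0 expr0n/= !mulr0 subr0 => h.
rewrite expRN -!mulrA ler_pdivrMl ?expR_gt0// mulrA.
rewrite -subr_ge0.
rewrite [X in _ - X](_ : _ = u s y / (m.+1)`!%:R * t ^+ m.+1); last by ring.
rewrite [2 * (_ * _)]mulrA; exact: le_trans (u_ge0 z s0) h.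
Qed.

(** The initial condition is known only as a limit, so [pam_path_le] is applied from time r to s at
    the origin and r is sent to 0. *)
Lemma pam_origin_ge s : 0 < s -> expR (- (2 * d%:R * s)) <= u s 0.
Proof.
move=> s0; have [_ _ h] := solu.
have := h 0; rewrite eqxx => u1.
rewrite expRN -div1r ler_pdivrMr ?expR_gt0//.
have c : (fun r => u r 0 ) @ 0^'+ --> (1 : R) by [].
apply: (cvgr_to_le c).
near=> r.
have r0 : 0 < r by [].
have rs : r <= s by near: r; exact: nbhs_right_le.
have := @pam_path_le r (s - r) 0 0 r0; rewrite subr_ge0 => /(_ rs).
rewrite subrr norm1_0 expr0 fact0 divr1 mulr1 (addrC r) subrK expRN ler_pdivrMl ?expR_gt0//.
move=> /le_trans; apply; rewrite mulrC ler_wpM2l ?u_ge0// ler_expR ler_wpM2l//.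
by rewrite gerBl ltW.
Unshelve. all: by end_near. Qed.

(** Dropping the inflow from the neighbours leaves the equation u' = (xi - 2d) u at the single
    site. *)
Lemma pam_stay_ge s t z : 0 < s -> 0 <= t ->
  expR ((xi z - 2 * d%:R) * t) * u s z <= u (s + t) z.
Proof.
move=> s0 t0.
pose f r := expR (- ((xi z - 2 * d%:R) * r)) * u (s + r) z.
have : f 0 <= f t.
  pose df : R -> R := fun r => expR (- ((xi z - 2 * d%:R) * r)) * neighbour_sum (u (s + r)) z.
  have fdf r : 0 <= r <= t -> is_derive r 1 f (df r).
    move=> /andP[r0 rt].
    have := is_derive_u z s0 r0 => H; apply: is_derive_eq.
    rewrite /df /GRing.scale/=; ring.
  apply: (is_derive_ndecr t0 fdf) => r /andP[r0 rt]; rewrite /df.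
  have sr0 : 0 < s + r by rewrite ltr_wpDr.
  rewrite mulr_ge0 ?expR_ge0//.
  by apply: neighbour_sum_ge0 => x; exact: u_ge0.
by rewrite /f mulr0 oppr0 expR0 mul1r addr0 expRN ler_pdivlMl ?expR_gt0.
Qed.

(** Half of [s] is spent at the origin, where the initial condition gives a positive mass, and half
    on the way to z; the remaining time is spent at z. The three jump costs add up to at most
    2dt. *)
Lemma pam_site_ge s t z : 0 < s -> s <= t ->
  expR (xi z * (t - s) - 2 * d%:R * t) *
    ((s / 2) ^+ norm1 z / (norm1 z)`!%:R) <= u t z.
Proof.
move=> s0 st.
have h1 := pam_origin_ge (divr_gt0 s0 (ltr0n _ 2)).
have s20 : 0 < s / 2 by lra.
have h2 := pam_path_le z 0 s20 (ltW s20); rewrite subr0 -splitr in h2.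
have ts : 0 <= t - s by rewrite subr_ge0.
have := pam_stay_ge z s0 ts; rewrite addrCA subrr addr0; apply: le_trans.
have -> : xi z * (t - s) - 2 * d%:R * t =
  (xi z - 2 * d%:R) * (t - s) + (- (2 * d%:R * (s / 2)) + - (2 * d%:R * (s / 2))).
  by field.
rewrite expRD -mulrA ler_wpM2l ?expR_ge0// (le_trans _ h2)//.
rewrite expRD mulrAC ler_wpM2l// mulr_ge0 ?expR_ge0// divr_ge0 ?exprn_ge0// ltW//.
Qed.

End solution_lower_bounds.

(** * Comparison with supersolutions *)

Section finite_sums.
Context {R : realType}.

Lemma is_derive_sum_seq (I : Type) (r : seq I) (h : I -> R -> R) (dh : I -> R)
    (x : R) : (forall i, is_derive x 1 (h i) (dh i)) ->
  is_derive x 1 (fun y => \sum_(i <- r) h i y) (\sum_(i <- r) dh i).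
Proof.
move=> hdh; elim: r => [|i r IH].
  rewrite big_nil (_ : (fun _ => _) = cst 0); last first.
    by apply/funext => y; rewrite big_nil.
  exact: is_derive_cst.
rewrite big_cons (_ : (fun _ => _) = (fun y => h i y + \sum_(j <- r) h j y)); last first.
  by apply/funext => y; rewrite big_cons.
exact: is_deriveD.
Qed.

Lemma cvg_sum_seq (I T : Type) (F : set_system T) (FF : Filter F) (r : seq I)
    (h : I -> T -> R) (l : I -> R) : (forall i, h i x @[x --> F] --> l i) ->
  \sum_(i <- r) h i x @[x --> F] --> \sum_(i <- r) l i.
Proof.
move=> hl; elim: r => [|i r IH].
  rewrite big_nil (_ : (fun _ => _) = cst 0); last first.
    by apply/funext => y; rewrite big_nil.
  exact: cvg_cst.
rewrite big_cons (_ : (fun _ => _) = (fun y => h i y + \sum_(j <- r) h j y)); last first.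
  by apply/funext => y; rewrite big_cons.
exact: cvgD.
Qed.

End finite_sums.

Section box.
Context {d : nat}.
Implicit Types z : 'rV[int]_d.

(** The cube [-n, n]^d as a finite type. It contains the l^1 ball of radius n, and its product
    structure lets exponential sums factor over coordinates. *)
Definition box_index n := {ffun 'I_d -> 'I_(n.*2.+1)}.

Definition box_point n (k : box_index n) : 'rV[int]_d :=
  \row_i ((k i)%:Z - n%:Z).

Lemma box_point_inj n : injective (@box_point n).
Proof.
move=> k l /rowP kl; apply/ffunP => i; apply: val_inj => /=.
by have := kl i; rewrite !mxE; lia.
Qed.

Lemma absz_le_norm1 z i : (absz (z 0%R i) <= norm1 z)%N.
Proof. by rewrite (norm1D1 z i) leq_addr. Qed.

Lemma box_point_surj n z : (norm1 z <= n)%N -> exists k, z = @box_point n k.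
Proof.
move=> zn; have zin i : (absz (z 0%R i + n%:Z)%R < n.*2.+1)%N.
  have := leq_trans (absz_le_norm1 z i) zn; lia.
exists [ffun i => Ordinal (zin i)]; apply/rowP => i; rewrite !mxE ffunE /=.
have := leq_trans (absz_le_norm1 z i) zn; lia.
Qed.

Lemma norm1N z : norm1 (- z) = norm1 z.
Proof. by apply: eq_bigr => i _; rewrite mxE abszN. Qed.

End box.

Section comparison.
Context {R : realType} {d : nat}.
Variables (xi : 'rV[int]_d -> R) (f df : R -> 'rV[int]_d -> R) (t : R) (Q : nat).
Hypothesis xi0 : forall z, 0 <= xi z.
Hypothesis t0 : 0 < t.
Hypothesis fdf : forall (s : R) z, 0 < s <= t -> is_derive s (1 : R) (f ^~ z) (df s z).
Hypothesis super : forall (s : R) z, 0 < s <= t -> (norm1 z < Q)%N ->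
  lattice_laplacian (f s) z + xi z * f s z <= df s z.
Hypothesis boundary : forall (s : R) z, 0 < s <= t -> (Q <= norm1 z)%N -> 0 <= f s z.
Hypothesis initial : forall z, exists2 l : R, 0 <= l & f s z @[s --> 0^'+] --> l.

(* Gronwall's argument on the sum of the squared negative parts. *)
Let m s z := Num.min (f s z) 0.
Let G s := \sum_(k : @box_index d Q) m s (box_point k) ^+ 2.
Let dG s := \sum_(k : @box_index d Q) (2 * m s (box_point k) * df s (box_point k)).
Let Xi := \sum_(k : @box_index d Q) xi (box_point k).
Let C := \sum_(k : @box_index d Q) (2 * d%:R + 2 * Xi).

Let m_le0 s z : m s z <= 0.
Proof. by rewrite /m ge_min lexx orbT. Qed.

Let m_le s z : m s z <= f s z.
Proof. by rewrite /m ge_min lexx. Qed.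

Let G_ge0 s : 0 <= G s.
Proof. by apply: sumr_ge0 => k _; rewrite sqr_ge0. Qed.

Let m_le_G s z : 0 < s <= t -> m s z ^+ 2 <= G s.
Proof.
move=> st; have [Qz|/ltnW zQ] := leqP Q (norm1 z).
  by rewrite /m min_r ?boundary// expr0n.
have [k ->] := box_point_surj zQ.
rewrite /G (bigD1 k)//= lerDl sumr_ge0// => l _; exact: sqr_ge0.
Qed.

Let dG_le s : 0 < s <= t -> dG s <= C * G s.
Proof.
move=> st; rewrite /dG /C mulr_suml; apply: ler_sum => k _.
set z := box_point k.
have Xiz : xi z <= Xi.
  by rewrite /Xi (bigD1 k)//= lerDl sumr_ge0.
have Xi0 : 0 <= Xi by apply: sumr_ge0.
have [Qz|zQ] := leqP Q (norm1 z).
  rewrite /m min_r ?boundary// mulr0 mul0r mulr_ge0//.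
  by rewrite addr_ge0// mulr_ge0.
have h1 := super st zQ; rewrite lattice_laplacianE in h1.
have mz := m_le0 s z.
have h2 : 2 * m s z * df s z <= 2 * m s z * (neighbour_sum (f s) z -
   2 * d%:R * f s z + xi z * f s z).
  by rewrite ler_wnM2l//; lra.
apply: (le_trans h2).
have mm : m s z * f s z = m s z ^+ 2.
  by rewrite /m /Num.min; case: ifPn => _; rewrite ?expr2// !mul0r.
(* As m(z) <= 0 and f(y) >= m(y), the product is at most 2 m(z) m(y), hence at most m(z)^2 +
   m(y)^2. *)
have h3 y : 2 * m s z * f s y <= m s z ^+ 2 + G s.
  have := m_le_G y st; have := m_le s y; have : 0 <= (m s z - m s y) ^+ 2 by exact: sqr_ge0.
  by nra.
have h4 : 2 * m s z * neighbour_sum (f s) z <= 2 * d%:R * (m s z ^+ 2 + G s).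
  have -> : 2 * m s z * neighbour_sum (f s) z =
      neighbour_sum (fun y => 2 * m s z * f s y) z.
    by rewrite /neighbour_sum mulr_sumr; apply: eq_bigr => i _; rewrite mulrDr.
  by apply: le_neighbour_sum => i; exact: h3.
rewrite mulrDr mulrBr.
have -> : 2 * m s z * (2 * d%:R * f s z) = 4 * d%:R * m s z ^+ 2.
  by rewrite -mm; ring.
have -> : 2 * m s z * (xi z * f s z) = 2 * xi z * m s z ^+ 2.
  by rewrite -mm; ring.
have h5 : xi z * m s z ^+ 2 <= Xi * G s.
  by apply: ler_pM => //; [exact: sqr_ge0|exact: m_le_G].
have h6 : 0 <= d%:R * m s z ^+ 2 by rewrite mulr_ge0// sqr_ge0.
by nra.
Qed.

(** e^(-Cs) G(s) does not increase on (0, t] and tends to 0 at 0, because the initial limits are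
    nonnegative; hence G(t) = 0. Box points outside the ball contribute nothing, by [boundary]. *)
Lemma lattice_comparison z : 0 <= f t z.
Proof.
pose H s := expR (- (C * s)) * G s.
have dH s : 0 < s <= t -> is_derive s 1 H (expR (- (C * s)) * (dG s - C * G s)).
  move=> st.
  have GdG : is_derive s 1 G (dG s).
    apply: is_derive_sum_seq => k.
    have := @is_derive1_comp R (fun y => (Num.min y 0) ^+ 2) (f^~ (box_point k)) s
      _ _ (is_derive_sqr_minr0 _) (fdf (box_point k) st).
    by [].
  by apply: is_derive_eq; rewrite /GRing.scale/=; ring.
have Hle s : 0 < s <= t -> H t <= H s.
  move=> /andP[s0 st].
  suff : (\- H) s <= (\- H) t by rewrite lerN2.
  have D r : s <= r <= t -> is_derive r 1 (\- H) (- (expR (- (C * r)) * (dG r - C * G r))).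
    move=> /andP[sr rt]; apply: is_deriveN; apply: dH.
    by rewrite rt andbT (lt_le_trans s0).
  apply: (is_derive_ndecr st D) => r /andP[sr rt].
  rewrite oppr_ge0 mulr_ge0_le0 ?expR_ge0// subr_le0 dG_le//.
  by rewrite rt andbT (lt_le_trans s0).
have H0 : H s @[s --> 0^'+] --> 0.
  rewrite [X in _ --> X](_ : 0 = expR (- (C * 0)) * \sum_(k : @box_index d Q) 0); last first.
    by rewrite big1 ?mulr0.
  apply: cvgM.
    have E : is_derive (0 : R) 1 (fun s : R => expR (- (C * s))) (- C * expR (- (C * 0))).
      by apply: is_derive_eq; rewrite /GRing.scale/=; ring.
    exact: (is_derive_cvg_right E).
  apply: cvg_sum_seq => k; have [l l0 fl] := initial (box_point k).
  rewrite [X in _ --> X](_ : 0 = (Num.min l 0) ^+ 2); last by rewrite min_r// expr0n.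
  apply: (cvg_comp (f ^~ (box_point k)) (fun y : R => (Num.min y 0) ^+ 2) fl).
  exact: is_derive_continuous (is_derive_sqr_minr0 l).
have Ht : H t <= 0.
  apply: (cvgr_to_ge H0); near=> s; apply: Hle.
  by apply/andP; split; near: s; [exact: nbhs_right_gt|exact: nbhs_right_le].
have Gt : G t <= 0 by move: Ht; rewrite /H pmulr_rle0// expR_gt0.
have tt : 0 < t <= t by rewrite t0 lexx.
have := le_trans (m_le_G z tt) Gt.
have := m_le t z; have := m_le0 t z; nra.
Unshelve. all: by end_near. Qed.

End comparison.

Section solution_upper_bound.
Context {R : realType} {d : nat}.
Variables (xi : 'rV[int]_d -> R) (u : R -> 'rV[int]_d -> R).
Hypothesis xi0 : forall z, 0 <= xi z.
Hypothesis solu : nonneg_pam_solution xi u.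
Hypothesis xi_sublinear : forall c : R, 0 < c ->
  exists A : R, forall z, xi z <= A + c * (norm1 z)%:R.
Variables (t lam : R) (S : nat -> R).
Hypothesis t0 : 0 < t.
Hypothesis S0 : S 0%N = 0.
Hypothesis Snd : forall n, S n <= S n.+1.
Hypothesis lamS : forall z,
  xi z + 2 * d%:R * (expR (S (norm1 z) - S (norm1 z).-1) - 1) <=
  lam + S (norm1 z) / (2 * t).

(** The weight of S falls from 1 to 1/2 on [0, t]: its time derivative supplies the term S / 2t of
    [lamS], and the half left at time t makes the sum over z converge. *)
Let w (s : R) (z : 'rV[int]_d) := expR (lam * s - S (norm1 z) * (1 - s / (2 * t))).

Let w_super (s : R) z : 0 < s <= t ->
  lattice_laplacian (w s) z + xi z * w s z <=
  (lam + S (norm1 z) / (2 * t)) * w s z.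
Proof.
move=> /andP[s0 st].
have c1 : s / (2 * t) <= 1 by rewrite ler_pdivrMr ?mulr_gt0//; lra.
have c0 : 0 <= s / (2 * t) by rewrite divr_ge0 ?mulr_ge0 ?ltW.
have w0 y : 0 < w s y by exact: expR_gt0.
have Spred : S (norm1 z).-1 <= S (norm1 z).
  by case: (norm1 z) => [|n] //=.
(* Outward, S does not decrease, so w does not increase; inward, w gains at most the full increment
   of S, since the weight is at most 1. *)
have hy y : norm1 y = (norm1 z).+1 \/ norm1 z = (norm1 y).+1 ->
    w s y <= expR (S (norm1 z) - S (norm1 z).-1) * w s z.
  move=> h; rewrite /w -expRD ler_expR; case: h => [->|h].
    have := Snd (norm1 z); nra.
  rewrite h /= in Spred *; nra.
have hn : neighbour_sum (w s) z <=
    2 * d%:R * (expR (S (norm1 z) - S (norm1 z).-1) * w s z).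
  apply: le_neighbour_sum => i; apply: hy.
    by have [] := norm1_add z i; [left|right].
  by have [] := norm1_sub z i; [left|right].
rewrite lattice_laplacianE.
apply: (le_trans (lerD (lerB hn (lexx _)) (lexx _))).
have := lamS z; rewrite -(ler_pM2r (w0 z)); lra.
Qed.

Let w_derive (s : R) z :
  is_derive s 1 (w ^~ z) ((lam + S (norm1 z) / (2 * t)) * w s z).
Proof.
have -> : w ^~ z = (fun s => expR ((lam + S (norm1 z) / (2 * t)) * s - S (norm1 z))).
  apply/funext => r; congr expR; have t00 : t != 0 by rewrite gt_eqF.
  by field.
apply: is_derive_eq; rewrite /GRing.scale/= /w.
have -> : lam * s - S (norm1 z) * (1 - s / (2 * t)) =
   (lam + S (norm1 z) / (2 * t)) * s - S (norm1 z).
  have t00 : t != 0 by rewrite gt_eqF.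
  by field.
ring.
Qed.

(* A supersolution growing like |z|!; it dominates any nonnegative solution
   near infinity, which takes the place of a uniqueness theorem. *)
Let B := 4 * d.+1%:R * expR 1 * t.
Let h (A s : R) (z : 'rV[int]_d) := expR ((A + (norm1 z)%:R / t) * s) *
  ((norm1 z)`!%:R / B ^+ norm1 z).

Let B0 : 0 < B.
Proof. by rewrite !mulr_gt0// expR_gt0. Qed.

Let h_gt0 A s z : 0 < h A s z.
Proof. by rewrite !mulr_gt0 ?expR_gt0 ?invr_gt0 ?exprn_gt0 ?ltr0n ?fact_gt0. Qed.

Let h_super : exists2 A : R, 0 <= A & forall (s : R) z, 0 < s <= t ->
  lattice_laplacian (h A s) z + xi z * h A s z <=
  (A + (norm1 z)%:R / t) * h A s z.
Proof.
(* The rate |z| / t of [h] is split in two halves: one absorbs the growth of xi, the other the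
   outward neighbours, for which [B] was chosen. Inward neighbours cost a constant, put into A. *)
have [A1 A1xi] := xi_sublinear (divr_gt0 (ltr0n R 1) (mulr_gt0 (ltr0n R 2) t0)).
have [A [A0 AA AB]] : exists A : R, [/\ 0 <= A, A1 + 1 / (2 * t) + 2 * d%:R * B <= A & 0 <= A].
  exists (Num.max 0 (A1 + 1 / (2 * t) + 2 * d%:R * B)).
  by split; rewrite le_max lexx ?orbT.
exists A => // s z /andP[s0 st].
set r := norm1 z.
have st1 : s / t <= 1 by rewrite ler_pdivrMr// mul1r.
have st0 : 0 <= s / t by rewrite divr_ge0// ltW.
have hz0 := h_gt0 A s z.
have up y : norm1 y = r.+1 -> h A s y <= r.+1%:R * expR 1 / B * h A s z.
  move=> yr; rewrite /h yr -/r factS exprS natrM.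
  have -> : (A + r.+1%:R / t) * s = (A + r%:R / t) * s + s / t.
    by rewrite -[r.+1%:R]natr1; field; rewrite gt_eqF.
  rewrite expRD.
  have -> : expR ((A + r%:R / t) * s) * expR (s / t) *
     (r.+1%:R * r`!%:R / (B * B ^+ r)) =
    r.+1%:R * expR (s / t) / B * (expR ((A + r%:R / t) * s) * (r`!%:R / B ^+ r)).
    by field; rewrite expf_neq0 ?gt_eqF.
  rewrite ler_wpM2r//; first exact: ltW.
  by rewrite ler_pM2r ?invr_gt0// ler_wpM2l// ler_expR.
have down y : r = (norm1 y).+1 -> h A s y <= B * h A s z.
  move=> ry; rewrite /h -/r ry factS exprS natrM; set n := norm1 y.
  have -> : B * (expR ((A + n.+1%:R / t) * s) * (n.+1%:R * n`!%:R / (B * B ^+ n)))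
    = n.+1%:R * (expR ((A + n.+1%:R / t) * s) * (n`!%:R / B ^+ n)).
    by field; rewrite expf_neq0 ?gt_eqF.
  rewrite -[leLHS]mul1r ler_pM ?ler1n//.
    by rewrite !mulr_ge0 ?expR_ge0 ?invr_ge0 ?exprn_ge0 ?ltW.
  rewrite ler_wpM2r ?mulr_ge0 ?invr_ge0 ?exprn_ge0 ?(ltW B0)//.
  by rewrite ler_expR ler_wpM2r ?(ltW s0)// lerD2l ler_wpM2r ?invr_ge0 ?(ltW t0)// ler_nat.
have Bh : 0 <= B * h A s z by rewrite mulr_ge0// ltW.
have uh : 0 <= r.+1%:R * expR 1 / B * h A s z.
  by rewrite mulr_ge0 ?(ltW hz0)// divr_ge0 ?(ltW B0)// mulr_ge0 ?expR_ge0.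
have hn : neighbour_sum (h A s) z <=
    2 * d%:R * ((r.+1%:R * expR 1 / B + B) * h A s z).
  apply: le_neighbour_sum => i; rewrite [leRHS]mulrDl.
    have [/up|/down] := norm1_add z i => /le_trans; apply.
      by rewrite lerDl.
    by rewrite lerDr.
  have [/up|/down] := norm1_sub z i => /le_trans; apply.
    by rewrite lerDl.
  by rewrite lerDr.
rewrite lattice_laplacianE.
apply: (le_trans (lerD (lerB hn (lexx _)) (lexx _))).
rewrite [leLHS](_ : _ = (2 * d%:R * (r.+1%:R * expR 1 / B + B) - 2 * d%:R + xi z) * h A s z); last by ring.
rewrite ler_wpM2r ?(ltW hz0)//.
have hB : 2 * d%:R * (r.+1%:R * expR 1 / B) <= r.+1%:R / (2 * t).
  have -> : 2 * d%:R * (r.+1%:R * expR 1 / B) = r.+1%:R / (2 * t) * (d%:R / d.+1%:R).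
    rewrite /B; field.
    by rewrite ?gt_eqF ?expR_gt0// -?natr1 ?nat1r ?pnatr_eq0.
  rewrite ler_piMr ?divr_ge0 ?mulr_ge0 ?(ltW t0)//.
  by rewrite ler_pdivrMr// mul1r ler_nat.
have := A1xi z; rewrite -/r; rewrite -[r.+1%:R]natr1 in hB *.
have -> : 1 / (2 * t) * r%:R = r%:R / (2 * t) by rewrite mul1r mulrC.
have rr : (r%:R + 1) / (2 * t) = r%:R / (2 * t) + 1 / (2 * t) by rewrite mulrDl.
rewrite rr in hB.
have -> : r%:R / t = r%:R / (2 * t) + r%:R / (2 * t).
  by field; rewrite gt_eqF.
have d0 : 0 <= d%:R :> R by [].
nra.
Qed.

Let h_derive A (s : R) z :
  is_derive s 1 (h A ^~ z) ((A + (norm1 z)%:R / t) * h A s z).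
Proof. by apply: is_derive_eq; rewrite /GRing.scale/= /h; ring. Qed.

(** Mass at z can flow back to the origin: the path bound from z to 0, over a time of at least 2B,
    gives u(s, z) <= K r! / (2B)^r with r = |z|. Compared with the r! / B^r in [h] this gains 2^-r,
    whatever the size of K and e. *)
Let u_le_h A e : 0 <= A -> 0 < e -> exists Q, forall (s : R) z,
  0 < s <= t -> (Q <= norm1 z)%N -> u s z <= e * h A s z.
Proof.
move=> A0 e0; pose T := t + 2 * B; pose K := expR (2 * d%:R * T) * u T 0.
have K0 : 0 <= K.
  have [h0 _ _] := solu; rewrite mulr_ge0 ?expR_ge0// h0//.
  by rewrite addr_gt0// mulr_gt0.
exists (Num.truncn (K / e)).+1 => s z /andP[s0 st] Qz.
have Ts : 0 <= T - s by rewrite /T; have := B0; lra.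
have := pam_path_le xi0 solu 0 z s0 Ts; rewrite sub0r norm1N.
rewrite (addrC s) subrK; set r := norm1 z => uT.
have hB : expR (- (2 * d%:R * T)) * ((2 * B) ^+ r / r`!%:R) * u s z <= u T 0.
  apply: le_trans uT; have [u0 _ _] := solu.
  apply: ler_wpM2r; first exact: u0.
  have B20 : 0 <= 2 * B by rewrite mulr_ge0// ltW.
  apply: ler_pM; first exact: expR_ge0.
  - by rewrite divr_ge0// exprn_ge0.
  - by rewrite ler_expR lerN2 ler_wpM2l ?mulr_ge0// gerBl ltW.
  rewrite ler_wpM2r ?invr_ge0// lerXn2r ?nnegrE//.
  by rewrite /T; lra.
have r0 : 0 < r`!%:R :> R by rewrite ltr0n fact_gt0.
have us : u s z <= K * (r`!%:R / (2 * B) ^+ r).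
  rewrite /K -mulrA mulrCA.
  move: hB; rewrite expRN -!mulrA ler_pdivrMl ?expR_gt0// mulrA.
  rewrite -ler_pdivlMl; last by rewrite divr_gt0// exprn_gt0// mulr_gt0.
  move=> /le_trans; apply; rewrite invf_div; lra.
apply: (le_trans us).
have Br : 0 < B ^+ r by rewrite exprn_gt0.
have -> : K * (r`!%:R / (2 * B) ^+ r) = (K / 2 ^+ r) * (r`!%:R / B ^+ r).
  by rewrite exprMn; field; rewrite !expf_neq0 ?gt_eqF.
have K2 : K / 2 ^+ r <= e.
  rewrite ler_pdivrMr ?exprn_gt0// -ler_pdivrMl// mulrC.
  have := truncnS_gt (K / e) => /ltW/le_trans; apply.
  rewrite -natrX ler_nat (leq_trans Qz)// ltnW// ltn_expl//.
apply: (le_trans (ler_wpM2r _ K2)); first by rewrite divr_ge0// ltW.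
rewrite ler_wpM2l ?(ltW e0)// /h ler_peMl ?divr_ge0 ?(ltW Br)//.
by rewrite -expR0 ler_expR mulr_ge0 ?(ltW s0)// addr_ge0// divr_ge0// ltW.
Qed.

Lemma pam_le z : u t z <= expR (lam * t - S (norm1 z) / 2).
Proof.
have [A A0 hA] := h_super.
have -> : lam * t - S (norm1 z) / 2 = lam * t - S (norm1 z) * (1 - t / (2 * t)).
  by field; rewrite gt_eqF.
apply/ler_addgt0Pr => e e0.
(* Normalised so that the perturbation equals e at the point (t, z) where the bound is wanted; Q
   then depends on e, but the conclusion does not. *)
pose e' := e / h A t z.
have e'0 : 0 < e' by rewrite divr_gt0.
have [Q Qu] := u_le_h A0 e'0.
pose f s y := w s y + e' * h A s y - u s y.
pose df s y := (lam + S (norm1 y) / (2 * t)) * w s y +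
  e' * ((A + (norm1 y)%:R / t) * h A s y) -
  (lattice_laplacian (u s) y + xi y * u s y).
have [u0 uD uI] := solu.
have fdf (s : R) y : 0 < s <= t -> is_derive s (1 : R) (f ^~ y) (df s y).
  move=> /andP[s0 _].
  have W := w_derive s y; have H := h_derive A s y; have U := uD s y s0.
  by apply: is_derive_eq; rewrite /df /GRing.scale/=; ring.
have lapf (s : R) y : lattice_laplacian (f s) y =
    lattice_laplacian (w s) y + e' * lattice_laplacian (h A s) y -
    lattice_laplacian (u s) y.
  rewrite /lattice_laplacian mulr_sumr -big_split -sumrB/=.
  by apply: eq_bigr => i _; rewrite /f; ring.
have := @lattice_comparison R d xi f df t Q xi0 t0 fdf.
have super (s : R) y : 0 < s <= t -> (norm1 y < Q)%N ->
    lattice_laplacian (f s) y + xi y * f s y <= df s y.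
  move=> st _; rewrite lapf /df /f.
  have := w_super y st; have := hA s y st; rewrite -(ler_pM2l e'0); lra.
have bd (s : R) y : 0 < s <= t -> (Q <= norm1 y)%N -> 0 <= f s y.
  move=> st Qy; rewrite /f subr_ge0 (le_trans (Qu _ _ st Qy))//.
  by rewrite lerDr expR_ge0.
have init y : exists2 l : R, 0 <= l & f s y @[s --> 0^'+] --> l.
  exists (w 0 y + e' * h A 0 y - (y == 0)%:R).
    have := mulr_gt0 e'0 (h_gt0 A 0 y).
    have := expR_gt0 (lam * 0 - S (norm1 y) * (1 - 0 / (2 * t))); rewrite -/(w 0 y).
    have [->|y0] := eqVneq y 0; last by rewrite /=; lra.
    (* Here [S0] enters: at the origin w must compensate the initial mass 1 of u. *)
    have -> : w 0 0 = 1 by rewrite /w norm1_0 S0 !mul0r mulr0 subr0 expR0.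
    by rewrite /=; lra.
  apply: cvgB (uI y); apply: cvgD.
    exact: is_derive_cvg_right (w_derive 0 y).
  apply: cvgM; first exact: cvg_cst.
  exact: is_derive_cvg_right (h_derive A 0 y).
move=> /(_ super bd init z).
rewrite /f /e' divfK ?gt_eqF ?h_gt0//; rewrite /w; lra.
Qed.

End solution_upper_bound.

(** * The total mass *)

Section total_mass_bounds.
Context {R : realType} {d : nat}.
Implicit Types (z : 'rV[int]_d) (f : 'rV[int]_d -> R) (a : R).

Lemma sum_le_box (s : seq 'rV[int]_d) n f : uniq s ->
  (forall z, z \in s -> (norm1 z <= n)%N) -> (forall z, 0 <= f z) ->
  \sum_(z <- s) f z <= \sum_(k : @box_index d n) f (box_point k).
Proof.
move=> us sn f0.
have P : perm_eq s [seq box_point k | k <- enum (@box_index d n) & box_point k \in s].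
  apply: uniq_perm => //.
    by rewrite (map_inj_uniq (@box_point_inj d n)) filter_uniq// enum_uniq.
  move=> z; apply/idP/mapP => [zs|[k]]; last by rewrite mem_filter => /andP[? _ ->].
  have [k zk] := box_point_surj (sn _ zs); exists k => //.
  by rewrite mem_filter -zk zs mem_enum.
rewrite (perm_big _ P)/=.
rewrite big_map big_filter big_enum_cond/=.
rewrite [leRHS](bigID (fun k => box_point k \in s))/= lerDl.
by apply: sumr_ge0.
Qed.

Lemma sum_geometric_le a n : 0 < a -> \sum_(j < n) expR (- a) ^+ j.+1 <= a^-1.
Proof.
move=> a0; set q := expR (- a).
have q0 : 0 < q by exact: expR_gt0.
(* e^a >= 1 + a bounds the ratio q by 1 / (1 + a), which gives q / (1 - q) <= 1 / a. *)
have q1 : (1 + a) * q <= 1.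
  by rewrite /q expRN ler_pdivrMr ?expR_gt0// mul1r expR_ge1Dx.
have h : a * (\sum_(j < n) q ^+ j.+1) <= 1 - q ^+ n.
  elim: n => [|n IH]; first by rewrite big_ord0 mulr0 expr0 subrr.
  rewrite big_ord_recr/= mulrDr.
  have qn : 0 < q ^+ n by rewrite exprn_gt0.
  rewrite exprS; nra.
have qn : 0 < q ^+ n by rewrite exprn_gt0.
by rewrite -[leRHS]mulr1 ler_pdivlMl//; lra.
Qed.

Lemma sum_expR_interval_le a n : 0 < a ->
  \sum_(j < n.*2.+1) expR (- (a * (absz (j%:Z - n%:Z)%R)%:R)) <= 1 + 2 / a.
Proof.
move=> a0.
have E (m : nat) : expR (- (a * m%:R)) = expR (- a) ^+ m.
  by rewrite -mulNr expRM_natr.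
rewrite -(big_mkord xpredT (fun j => expR (- (a * (absz (j%:Z - n%:Z)%R)%:R)))).
rewrite (@big_cat_nat _ _ _ n)//=; last by rewrite -addnn -addnS leq_addr.
have -> : \sum_(0 <= j < n) expR (- (a * (absz (j%:Z - n%:Z)%R)%:R)) =
    \sum_(j < n) expR (- a) ^+ j.+1.
  rewrite big_nat_rev/= big_mkord; apply: eq_bigr => j _.
  by rewrite -E; congr (expR (- (a * _%:R))); have := ltn_ord j; lia.
have -> : \sum_(n <= j < n.*2.+1) expR (- (a * (absz (j%:Z - n%:Z)%R)%:R)) =
    1 + \sum_(j < n) expR (- a) ^+ j.+1.
  rewrite -{1}[n]add0n big_addn.
  have -> : (n.*2.+1 - n = n.+1)%N by lia.
  rewrite big_mkord big_ord_recl/=; congr (_ + _).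
    by rewrite add0n subrr absz0 mulr0 oppr0 expR0.
  apply: eq_bigr => j _; rewrite -E; congr (expR (- (a * _%:R))).
  by rewrite /bump /=; lia.
have := sum_geometric_le n a0; lra.
Qed.

(** The exponential of the l^1 norm factors over coordinates. The bound does not depend on n, so it
    passes to the sum over the whole lattice. *)
Lemma sum_expR_box_le a n : 0 < a ->
  \sum_(k : @box_index d n) expR (- (a * (norm1 (box_point k))%:R)) <=
  (1 + 2 / a) ^+ d.
Proof.
move=> a0.
have -> : \sum_(k : @box_index d n) expR (- (a * (norm1 (box_point k))%:R)) =
    \sum_(k : @box_index d n)
      \prod_(i < d) expR (- (a * (absz ((k i)%:Z - n%:Z)%R)%:R)).
  apply: eq_bigr => k _; rewrite -expR_sum; congr expR.
  rewrite sumrN -mulr_sumr -natr_sum; congr (- (a * _%:R)).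
  by apply: eq_bigr => i _; rewrite mxE.
rewrite -(bigA_distr_bigA (fun (i : 'I_d) (j : 'I_(n.*2.+1)) =>
  expR (- (a * (absz (j%:Z - n%:Z)%R)%:R)))).
rewrite prodr_const card_ord lerXn2r ?nnegrE//.
- by apply: sumr_ge0 => j _; exact: expR_ge0.
- by rewrite addr_ge0// divr_ge0// ltW.
- exact: sum_expR_interval_le.
Qed.

Lemma growth_rate_ge (u : R -> 'rV[int]_d -> R) (t x : R) z : 0 < t ->
  (forall y, 0 <= u t y) -> expR (x * t) <= u t z ->
  (x%:E <= growth_rate u t)%E.
Proof.
move=> t0 u0 xu.
have h : ((expR (x * t))%:E <= total_mass u t)%E.
  rewrite /total_mass; apply: esum_ge; exists [set z]; first by split => //.
  by rewrite fsbig_set1 lee_fin.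
rewrite /growth_rate muleC lee_pdivlMr// -EFinM.
have -> : (x * t)%:E = lne ((expR (x * t))%:E) by rewrite lne_EFin ?expR_gt0// expRK.
rewrite lee_lne ?in_itv/= ?leey ?lee_fin ?expR_ge0 ?andbT//.
by rewrite (le_trans _ h)// lee_fin expR_ge0.
Qed.

Lemma growth_rate_le (u : R -> 'rV[int]_d -> R) (t x a : R) : 0 < t -> 0 < a ->
  (forall y, 0 <= u t y) ->
  (forall y, u t y <= expR (x * t - a * (norm1 y)%:R)) ->
  (growth_rate u t <= (x + d%:R * ln (1 + 2 / a) / t)%:E)%E.
Proof.
move=> t0 a0 u0 xu.
pose M := expR (x * t) * (1 + 2 / a) ^+ d.
have c0 : 0 < 1 + 2 / a by rewrite addr_gt0// divr_gt0.
have M0 : 0 < M by rewrite mulr_gt0 ?expR_gt0// exprn_gt0.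
have h : (total_mass u t <= M%:E)%E.
  apply: ge_ereal_sup => _ [A [finA _] <-].
  rewrite fsbig_finite//= sumEFin lee_fin.
  pose n := \max_(z <- fset_set A) norm1 z.
  apply: (@le_trans _ _ (\sum_(k : @box_index d n) u t (box_point k))).
    apply: sum_le_box => //; first exact: fset_uniq.
    by move=> z zA; exact: leq_bigmax_seq.
  apply: (@le_trans _ _ (\sum_(k : @box_index d n)
     expR (x * t) * expR (- (a * (norm1 (box_point k))%:R)))).
    by apply: ler_sum => k _; rewrite -expRD.
  by rewrite -mulr_sumr ler_wpM2l ?expR_ge0// sum_expR_box_le.
rewrite /growth_rate muleC lee_pdivrMr// -EFinM.
have -> : ((x + d%:R * ln (1 + 2 / a) / t) * t)%:E = lne M%:E.
  rewrite lne_EFin// /M lnM ?posrE ?expR_gt0 ?exprn_gt0// expRK lnXn//.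
  by congr EFin; rewrite -mulr_natr; field; rewrite gt_eqF.
rewrite lee_lne ?in_itv/= ?leey ?lee_fin ?(ltW M0) ?andbT//.
by apply: esum_ge0 => z _; rewrite lee_fin.
Qed.

End total_mass_bounds.

(** * Borel-Cantelli lemmas *)

Section borel_cantelli.
Context d (T : measurableType d) (R : realType) (P : probability T R).
Implicit Types (A G : nat -> set T).

(** The convergent half of Borel-Cantelli, with summability asked for in telescoping form; the uses
    below take [c] proportional to 1 / ln k, 1 / (k - 1) and 2^-k. *)
Lemma ae_eventually_notin A (c : nat -> R) k0 :
  (forall k, measurable (A k)) -> (forall k, 0 <= c k) ->
  (forall k, (k0 <= k)%N -> (P (A k) <= (c k - c k.+1)%:E)%E) ->
  {ae P, forall w, exists k1, forall k, (k1 <= k)%N -> ~ A k w}.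
Proof.
move=> mA c0 PA; pose F n := A (n + k0)%N.
have mF n : measurable (F n) by exact: mA.
have sF : (\sum_(n <oo) P (F n) < +oo)%E.
  apply: (@le_lt_trans _ _ (c k0)%:E); last exact: ltry.
  apply: lime_le; first exact: is_cvg_nneseries.
  apply: nearW => n.
  apply: (@le_trans _ _ (\sum_(0 <= i < n) (c (i + k0)%N - c (i + k0).+1)%:E)%E).
    by apply: lee_sum => i _; apply: PA; exact: leq_addl.
  rewrite sumEFin lee_fin -[leLHS]opprK -sumrN.
  under eq_bigr do rewrite opprB -addSn.
  rewrite (@telescope_sumr _ 0 n (fun i => c (i + k0)%N))// add0n opprB gerBl//.
exists (lim_sup_set F); split.
- by apply: bigcapT_measurable => n; exact: bigcup_measurable.
- exact: lim_sup_set_cvg0.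
- move=> w /= /forallNP nw k _ /=.
  have /existsNP[n /not_implyP[kn /contrapT An]] := nw (k + k0)%N.
  exists (n - k0)%N => /=; first by move: kn => /=; lia.
  by rewrite /F subnK// (leq_trans _ kn)//= leq_addl.
Qed.

(** The divergent half, with independence already turned into a bound on joint non-occurrence. The
    harmonic sum appears because every event used has probability about 1 / k. *)
Lemma ae_frequently_in A K :
  (forall k, measurable (A k)) ->
  (forall m n, (K <= m)%N -> (P [set w | forall k, (m <= k < n)%N -> ~ A k w] <=
    (expR (- \sum_(m <= k < n) k.+1%:R^-1))%:E)%E) ->
  {ae P, forall w, forall m, exists2 k, (m <= k)%N & A k w}.
Proof.
move=> mA PA; apply: ae_foralln => m.
pose B n := [set w | forall k, (m + K <= k < n)%N -> ~ A k w].
have mB n : measurable (B n).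
  have -> : B n = \bigcap_(k in [set k | (m + K <= k < n)%N]) (~` A k).
    by apply/seteqP; split => w h k /h.
  by apply: bigcap_measurableType => k _; exact: measurableC.
pose N := \bigcap_n B n.
have mN : measurable N by exact: bigcapT_measurable.
exists N; split => //.
  apply/eqP; rewrite eq_le measure_ge0 andbT.
  apply/lee_addgt0Pr => e e0; rewrite add0e.
  have [M Me] : exists M : R, expR (- M) <= e.
    by exists (- ln e); rewrite opprK lnK.
  have [n Mn] : exists n, M <= \sum_(m + K <= k < n) k.+1%:R^-1.
    apply: contrapT => /forallNP nM.
    apply: (@dvg_harmonic R); apply: nondecreasing_is_cvgn.
      by apply: nondecreasing_series => i _; rewrite harmonic_ge0.
    exists (\sum_(0 <= k < m + K) k.+1%:R^-1 + M) => _ [n _ <-].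
    rewrite /series/=; have [mn|nm] := leqP (m + K) n.
      rewrite (big_cat_nat (leq0n _) mn)/= lerD2l ltW// ltNge; exact/negP.
    have M0 : 0 <= M.
      by have /negP := nM (m + K)%N; rewrite big_geq// -ltNge => /ltW.
    rewrite (big_cat_nat (leq0n _) (ltnW nm))/= -addrA lerDl addr_ge0//.
    by apply: sumr_ge0 => i _; rewrite invr_ge0.
  have NB : (P N <= P (B n))%E by apply: le_measure; rewrite ?inE// => w; apply.
  apply: (le_trans NB); apply: (le_trans (PA _ _ (leq_addl _ _))).
  by rewrite lee_fin (le_trans _ Me)// ler_expR lerN2.
move=> w /= nw n _ k /andP[mk _] Ak; apply: nw; exists k => //.
by rewrite (leq_trans _ mk)// leq_addr.
Qed.

Lemma independent_complement A (p : nat -> R) :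
  (forall k, measurable (A k)) ->
  (forall s : seq nat, uniq s ->
    P [set w | forall k, k \in s -> A k w] = (\prod_(k <- s) p k)%:E) ->
  forall s : seq nat, uniq s ->
    P [set w | forall k, k \in s -> ~ A k w] = (\prod_(k <- s) (1 - p k))%:E.
Proof.
move=> mA PA s us.
pose I (r : seq nat) := [set w | forall k, k \in r -> A k w].
pose J (r : seq nat) := [set w | forall k, k \in r -> ~ A k w].
have mI r : measurable (I r).
  have -> : I r = \bigcap_(k in [set` r]) A k by [].
  by apply: bigcap_measurableType => k _.
have mJ r : measurable (J r).
  have -> : J r = \bigcap_(k in [set` r]) (~` A k) by [].
  by apply: bigcap_measurableType => k _; exact: measurableC.
(* Mixed families make the induction work: an event to be complemented is first moved to the
   uncomplemented list, then subtracted. *)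
suff h r1 r2 : uniq (r1 ++ r2) ->
    P (I r1 `&` J r2) = (\prod_(k <- r1) p k * \prod_(k <- r2) (1 - p k))%:E.
  have := h [::] s us; rewrite big_nil mul1r => <-; congr (P _).
  by apply/seteqP; split => w // [].
elim: r2 r1 => [|a r2 IH] r1 u12.
  rewrite big_nil mulr1 -PA; last by rewrite cats0 in u12.
  by congr (P _); apply/seteqP; split => w // [].
have ua : uniq ((a :: r1) ++ r2).
  by rewrite -(perm_uniq (permEl (perm_catCA r1 [:: a] r2))).
have u1 : uniq (r1 ++ r2) by case/andP: ua.
have E : I r1 `&` J (a :: r2) = (I r1 `&` J r2) `\` (I (a :: r1) `&` J r2).
  apply/seteqP; split => w.
    move=> [Iw Jw]; split.
      by split => // k kr; apply: Jw; rewrite inE kr orbT.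
    by move=> [Iaw _]; apply: (Jw a); rewrite ?inE ?eqxx//; apply: Iaw; rewrite inE eqxx.
  move=> [[Iw Jw] n]; split => // k; rewrite inE => /orP[/eqP ->|]; last exact: Jw.
  by move=> Aa; apply: n; split => // l; rewrite inE => /orP[/eqP ->|]//; exact: Iw.
have sub : I (a :: r1) `&` J r2 `<=` I r1 `&` J r2.
  by move=> w [Iw Jw]; split => // k kr; apply: Iw; rewrite inE kr orbT.
have fin : (P (I r1 `&` J r2) < +oo)%E.
  by rewrite (le_lt_trans (probability_le1 _ _)) ?ltry//; exact: measurableI.
have D : P ((I r1 `&` J r2) `\` (I (a :: r1) `&` J r2)) =
    (P (I r1 `&` J r2) - P (I (a :: r1) `&` J r2))%E.
  rewrite measureD//; try exact: measurableI.
  by congr (_ - P _)%E; exact: setIidr.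
rewrite E D.
by rewrite !IH// -EFinB !big_cons; congr EFin; ring.
Qed.

Section counting.
Variables (I : finType) (A : I -> set T).
Hypothesis mA : forall i, measurable (A i).

Definition count_in w : nat := #|[pred i | `[< A i w >]]|.

Let N w : \bar R := (\sum_(i : I) (\1_(A i) w)%:E)%E.

Let NE w : N w = ((count_in w)%:R)%:E.
Proof.
rewrite /N sumEFin /count_in -sum1_card natr_sum [in RHS]big_mkcond/=; congr EFin.
apply: eq_bigr => i _; rewrite indicE [i \in _]inE.
have [Aw|nAw] := pselect (A i w); first by rewrite mem_set// asboolT.
by rewrite memNset// asboolF.
Qed.

Let mN : measurable_fun [set: T] N.
Proof. by apply: emeasurable_sum => i; apply/measurable_EFinP; exact: measurable_indic. Qed.

Lemma measurable_count_ge m : measurable [set w | (m <= count_in w)%N].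
Proof.
rewrite (_ : [set w | _] = setT `&` [set w | ((m%:R)%:E <= N w)%E]).
  exact: emeasurable_fun_c_infty.
by rewrite setTI; apply/seteqP; split => w; rewrite /= NE lee_fin ler_nat.
Qed.

(** Markov's inequality for the number of events that occur; with m = 1 it is the union bound. *)
Lemma probability_count_ge (q : R) m : (0 < m)%N ->
  (forall i, (P (A i) <= q%:E)%E) ->
  (P [set w | (m <= count_in w)%N] <= (#|I|%:R * q / m%:R)%:E)%E.
Proof.
move=> m0 PA; set E := [set w | _].
have N0 w : (0 <= N w)%E by apply: sume_ge0 => i _; rewrite lee_fin.
have mE : measurable E := measurable_count_ge m.
rewrite EFinM muleC lee_pdivlMl ?ltr0n//.
apply: (@le_trans _ _ (\int[P]_(w in E) (cst (m%:R)%:E w))%E).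
  by rewrite integral_cst.
apply: (@le_trans _ _ (\int[P]_(w in E) N w)%E).
  apply: ge0_le_integral => //.
  - by move=> w _; rewrite lee_fin.
  - exact: measurable_funTS.
  - by move=> w Ew; rewrite NE lee_fin ler_nat.
apply: (@le_trans _ _ (\int[P]_w N w)%E).
  by apply: ge0_subset_integral.
rewrite ge0_integral_sum//; last first.
  by move=> i; apply/measurable_EFinP; exact: measurable_indic.
apply: (@le_trans _ _ (\sum_(i : I) q%:E)%E).
  by apply: lee_sum => i _; rewrite integral_indic ?setIT ?setTI//; exact: PA.
by rewrite sumEFin lee_fin sumr_const -[leLHS]mulr_natl.
Qed.

Lemma count_in_gt0 w i : A i w -> (0 < count_in w)%N.
Proof. by move=> Aw; apply/card_gt0P; exists i; rewrite unfold_in/= asboolT. Qed.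

End counting.

End borel_cantelli.

(** * Extremes of the exponential field *)

Section product_bounds.
Context {R : realType}.

Lemma prod_1B_le_expR (I : eqType) (s : seq I) (q : I -> R) :
  (forall i, i \in s -> q i <= 1) ->
  \prod_(i <- s) (1 - q i) <= expR (- \sum_(i <- s) q i).
Proof.
move=> q1; rewrite -sumrN expR_sum 2!big_seq; apply: ler_prod => i si.
by rewrite subr_ge0 q1//= expR_ge1Dx.
Qed.

Lemma expR_le_prod_1B (I : eqType) (s : seq I) (q : I -> R) :
  (forall i, i \in s -> 0 <= q i <= 2^-1) ->
  expR (- (2 * \sum_(i <- s) q i)) <= \prod_(i <- s) (1 - q i).
Proof.
move=> q2; rewrite mulr_sumr -sumrN expR_sum 2!big_seq; apply: ler_prod => i si.
rewrite expR_ge0/= expRN; have /andP[q0 q1] := q2 i si.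
(* e^(-2q) <= 1 / (1 + 2q) <= 1 - q, as (1 - q)(1 + 2q) = 1 + q(1 - 2q) >= 1 for q <= 1/2. *)
have e0 := expR_gt0 (2 * q i); have := expR_ge1Dx (2 * q i).
rewrite -div1r ler_pdivrMr//; nra.
Qed.

End product_bounds.

Section exponential_field.
Context (R : realType) (disp : measure_display) (T : measurableType disp)
  (P : probability T R) (d : nat) (xi : 'rV[int]_d -> {RV P >-> R}).
Hypothesis xi_indep : mutually_independent xi.
Hypothesis xi_exp : forall z, standard_exponential (xi z).
Implicit Types (z : 'rV[int]_d) (J : {fset 'rV[int]_d}) (x : R).

Lemma measurable_field_le z x : measurable [set w | xi z w <= x].
Proof.
rewrite (_ : [set w | _] = xi z @^-1` `]-oo, x]).
  by rewrite -[X in measurable X]setTI; exact: measurable_funP.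
by apply/seteqP; split => w /=; rewrite in_itv.
Qed.

Lemma measurable_field_gt z x : measurable [set w | x < xi z w].
Proof.
rewrite (_ : [set w | _] = ~` [set w | xi z w <= x]).
  exact/measurableC/measurable_field_le.
by apply/seteqP; split => w /=; rewrite ltNge => /negP.
Qed.

Lemma probability_field_gt z x : (P [set w | (x < xi z w)%R] <= (expR (- x))%:E)%E.
Proof.
have [x0|x0] := leP 0 x; first by rewrite (xi_exp z x0).
rewrite (le_trans (probability_le1 P (measurable_field_gt z x)))// lee_fin.
by rewrite -expR0 ler_expR oppr_ge0 ltW.
Qed.

Lemma probability_field_le z x : 0 <= x ->
  P [set w | xi z w <= x] = (1 - expR (- x))%:E.
Proof.
move=> x0; rewrite (_ : [set w | _] = ~` [set w | x < xi z w]).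
  by rewrite probability_setC ?(xi_exp z x0)//; exact: measurable_field_gt.
by apply/seteqP; split => w /= => [h|/negP]; [apply/negP|]; rewrite -leNgt.
Qed.

Lemma probability_field_all_le J (h : 'rV[int]_d -> R) :
  (forall z, z \in J -> 0 <= h z) ->
  P [set w | forall z, z \in J -> xi z w <= h z] =
  (\prod_(z <- J) (1 - expR (- h z)))%:E.
Proof.
move=> h0; pose B z := [set` `]-oo, h z]].
rewrite (_ : [set w | _] = \bigcap_(z in [set` J]) (xi z @^-1` B z)).
  rewrite xi_indep; last by move=> z _; exact: measurable_itv.
  rewrite -prodEFin 2!big_seq; apply: eq_bigr => z zJ.
  rewrite -(probability_field_le z (h0 z zJ)); congr (P _).
by apply/seteqP; split => w H z /= zJ; have := H z zJ; rewrite /B/= in_itv.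
Qed.

Lemma measurable_field_all_le J (h : 'rV[int]_d -> R) :
  measurable [set w | forall z, z \in J -> xi z w <= h z].
Proof.
rewrite (_ : [set w | _] = \bigcap_(z in [set` J]) [set w | xi z w <= h z])//.
apply: fin_bigcap_measurable => // z _; exact: measurable_field_le.
Qed.

Lemma probability_field_blocks (J : nat -> {fset 'rV[int]_d})
    (h : nat -> 'rV[int]_d -> R) :
  (forall k l z, z \in J k -> z \in J l -> k = l) ->
  (forall k z, z \in J k -> 0 <= h k z) ->
  forall s : seq nat, uniq s ->
  P [set w | forall k, k \in s -> forall z, z \in J k -> xi z w <= h k z] =
  (\prod_(k <- s) \prod_(z <- J k) (1 - expR (- h k z)))%:E.
Proof.
move=> disjJ h0 s us.
(* The index of the block containing z, well defined by disjointness. It merges the thresholds [h k]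
   into one function on the union, to which independence applies directly. *)
pose block z := xget 0%N [set k | z \in J k].
have blockE k z : z \in J k -> block z = k.
  move=> zk; have bz : z \in J (block z).
    by apply: (@xgetPex _ 0%N [set k | z \in J k]); exists k.
  exact: disjJ bz zk.
pose K := seq_fset tt s; pose h' z := h (block z) z.
have inK k : (k \in K) = (k \in s) by rewrite seq_fsetE.
have U z : reflect (exists2 k, k \in s & z \in J k) (z \in (\bigcup_(k <- K) J k)%fset).
  apply: (iffP (bigfcupP _ _ _ _)) => [[k /andP[kK _] zk]|[k ks zk]].
    by exists k => //; rewrite -inK.
  by exists k => //; rewrite inK ks.
rewrite (_ : [set w | _] = [set w | forall z, z \in (\bigcup_(k <- K) J k)%fset -> xi z w <= h' z]).
  rewrite probability_field_all_le; last first.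
    by move=> z /U[k _ zk]; rewrite /h' (blockE k)// h0.
  rewrite partition_disjoint_bigfcup/=; last first.
    move=> k l _ _ kl; apply/fdisjointP => z zk; apply/negP => zl.
    by move: kl; rewrite (disjJ _ _ _ zk zl) eqxx.
  rewrite (perm_big _ (seq_fset_perm tt s)) undup_id//=; congr EFin; apply: eq_bigr => k _.
  by rewrite 2!big_seq; apply: eq_bigr => z zk; rewrite /h' (blockE k).
apply/seteqP; split => w H.
  by move=> z /U[k ks zk]; rewrite /h' (blockE k)//; exact: H.
move=> k ks z zk; have := H z; rewrite /h' (blockE k)//; apply.
by apply/U; exists k.
Qed.

Lemma field_ge0_ae : {ae P, forall w, forall z, 0 <= xi z w}.
Proof.
(* The lattice is enumerated by [unpickle], since countable intersections of almost sure events are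
   taken over the natural numbers. *)
have : {ae P, forall w, forall n, 
      if (choice.unpickle n : option 'rV[int]_d) is Some z then 0 <= xi z w else true}.
  apply: ae_foralln => n; case: (choice.unpickle n : option 'rV[int]_d) => [z|]; last exact: aeW.
  exists [set w | xi z w <= 0]; split.
  - exact: measurable_field_le.
  - by have := probability_field_le z (lexx 0); rewrite oppr0 expR0 subrr.
  - by move=> w /= /negP; rewrite -ltNge => /ltW.
by apply: filterS => w H z; have := H (choice.pickle z); rewrite choice.pickleK.
Qed.

(* lam k is chosen so that the expected number of sites of the k-th block above
   their threshold is at most ln (k + 1) / 2. *)
Lemma field_blocks_low_ae (J : nat -> {fset 'rV[int]_d}) (a lam : nat -> R) K :
  (forall k l z, z \in J k -> z \in J l -> k = l) ->
  (forall k, 0 < a k <= 1) ->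
  (forall k, (K <= k)%N ->
    lam k = d%:R * ln (3 / a k) + ln 2 - ln (ln k.+1%:R)) ->
  (forall k, ln 2 <= lam k) ->
  (0 < K)%N ->
  {ae P, forall w, forall m, exists2 k, (m <= k)%N &
    forall z, z \in J k -> xi z w <= lam k + a k * (norm1 z)%:R}.
Proof.
move=> disjJ a01 lamE lam2 K0.
pose h k z := lam k + a k * (norm1 z)%:R.
have h2 k z : ln 2 <= h k z.
  have /andP[ak0 _] := a01 k.
  by rewrite (le_trans (lam2 k))// lerDl mulr_ge0// ltW.
(* The upper bound 1/2, which comes from lam >= ln 2, is what [expR_le_prod_1B] requires. *)
have q2 k z : 0 <= expR (- h k z) <= 2^-1.
  rewrite expR_ge0/= -[leRHS](@lnK R) ?posrE ?invr_gt0//.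
  by rewrite ler_expR lnV ?posrE// lerN2.
pose A k := [set w | forall z, z \in J k -> xi z w <= h k z].
pose p k := \prod_(z <- J k) (1 - expR (- h k z)).
have mA k : measurable (A k) by exact: measurable_field_all_le.
have PA s : uniq s -> P [set w | forall k, k \in s -> A k w] = (\prod_(k <- s) p k)%:E.
  apply: probability_field_blocks => // k z _.
  by rewrite (le_trans _ (h2 k z))// ln_ge0// ler1n.
have p1 k : p k <= 1.
  apply: le_trans (prod_1B_le_expR _) _.
    by move=> z _; have /andP[_ /le_trans] := q2 k z; apply; rewrite invf_le1// ler1n.
  by rewrite -expR0 ler_expR oppr_le0 sumr_ge0// => z _; exact: expR_ge0.
have pk k : (K <= k)%N -> k.+1%:R^-1 <= p k.
  move=> Kk; apply: le_trans (expR_le_prod_1B _); last by move=> z _.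
  have /andP[ak0 ak1] := a01 k.
  have k1 : 1 < k.+1%:R :> R by rewrite ltr1n ltnS (leq_trans K0).
  have lk : 0 < ln k.+1%:R :> R by rewrite ln_gt0.
  rewrite -[leLHS](@lnK R) ?posrE ?invr_gt0// ler_expR lnV ?posrE// lerN2.
  pose n := \max_(z <- J k) norm1 z.
  have S1 : \sum_(z <- J k) expR (- h k z) <=
      expR (- lam k) * (1 + 2 / a k) ^+ d.
    apply: (@le_trans _ _ (\sum_(b : @box_index d n) expR (- h k (box_point b)))).
      apply: (@sum_le_box R d _ n (fun z => expR (- h k z))) => //.
      - exact: fset_uniq.
      - by move=> z zJ; exact: leq_bigmax_seq.
    apply: (@le_trans _ _ (expR (- lam k) *
      \sum_(b : @box_index d n) expR (- (a k * (norm1 (box_point b))%:R)))).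
      rewrite mulr_sumr; apply: ler_sum => b _.
      by rewrite -expRD /h opprD.
    by rewrite ler_wpM2l ?expR_ge0// sum_expR_box_le.
  (* As a k <= 1, 1 + 2 / a k is at most 3 / a k: hence the 3 in the formula for [lam]. *)
  have S2 : (1 + 2 / a k) ^+ d <= expR (d%:R * ln (3 / a k)).
    rewrite [d%:R * _]mulrC expRM_natr lnK ?posrE ?divr_gt0//.
    rewrite lerXn2r ?nnegrE ?addr_ge0 ?divr_ge0 ?(ltW ak0)//.
    have : 1 <= (a k)^-1 by rewrite invf_ge1.
    by lra.
  have S3 : expR (- lam k) * expR (d%:R * ln (3 / a k)) = ln k.+1%:R / 2.
    rewrite -expRD lamE//.
    rewrite (_ : _ + _ = ln (ln k.+1%:R) - ln 2); last by ring.
    by rewrite -ln_div ?posrE// lnK// posrE divr_gt0.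
  have := le_trans S1 (ler_wpM2l (expR_ge0 _) S2).
  by rewrite S3; lra.
apply: (ae_frequently_in (K := K)) => // m n Km.
rewrite (_ : [set w | _] = [set w | forall k, k \in index_iota m n -> ~ A k w]); last first.
  by apply/seteqP; split => w H k; have := H k; rewrite mem_index_iota.
rewrite (independent_complement mA PA) ?iota_uniq// lee_fin.
apply: (le_trans (prod_1B_le_expR _)); first by move=> k _.
rewrite ler_expR lerN2 !big_nat; apply: ler_sum => k /andP[mk _].
exact: pk (leq_trans Km mk).
Qed.

End exponential_field.

(** * Almost sure extremes on dyadic boxes and cubes *)

Section exponential_extremes.
Context (R : realType) (disp : measure_display) (T : measurableType disp)
  (P : probability T R) (d : nat) (xi : 'rV[int]_d -> {RV P >-> R}).
Hypothesis xi_indep : mutually_independent xi.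
Hypothesis xi_exp : forall z, standard_exponential (xi z).
Implicit Types (z : 'rV[int]_d) (k : nat).

Lemma exp2E k : 2 ^+ k = expR (k%:R * ln 2) :> R.
Proof. by rewrite mulrC expRM_natr lnK// posrE. Qed.

Lemma exp2XE k n : (2 ^+ k) ^+ n = expR (n%:R * k%:R * ln 2) :> R.
Proof. by rewrite -exprM exp2E mulnC natrM. Qed.

Lemma card_box_index_le k :
  #|@box_index d (2 ^ k)|%:R <= 4 ^+ d * expR (d%:R * k%:R * ln 2) :> R.
Proof.
rewrite card_ffun !card_ord -exp2XE -exprMn natrX lerXn2r ?nnegrE//.
by rewrite -natrX -natrM ler_nat; have := expn_gt0 2 k; lia.
Qed.

(* Summability of 1 / (k ln^2 k) through the telescoping series of 1 / ln k. *)
Lemma inv_ln_telescope k : (2 <= k)%N ->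
  expR (- (ln k.+1%:R + 2 * ln (ln k.+1%:R))) <=
  (ln k%:R)^-1 - (ln k.+1%:R)^-1 :> R.
Proof.
move=> k2; have k0 : 0 < k%:R :> R by rewrite ltr0n; lia.
have k10 : 0 < k.+1%:R :> R by [].
set a : R := ln k%:R; set b : R := ln k.+1%:R.
have a0 : 0 < a by rewrite ln_gt0// ltr1n.
have ba : k.+1%:R^-1 <= b - a.
  rewrite /a /b -ln_div ?posrE// -lerN2 -lnV ?posrE ?divr_gt0// invf_div.
  have -> : k%:R / k.+1%:R = 1 + (- k.+1%:R^-1) :> R.
    by rewrite -[k.+1%:R]natr1; field; rewrite natr1.
  by apply: le_ln1Dx; rewrite ltrN2 invf_lt1// ltr1n; lia.
have ab : a <= b by rewrite -subr_ge0 (le_trans _ ba)// invr_ge0.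
have b0 : 0 < b := lt_le_trans a0 ab.
have eb : expR (- b) = k.+1%:R^-1 by rewrite expRN lnK ?posrE.
have elb : expR (- ln b) = b^-1 by rewrite expRN lnK ?posrE.
rewrite opprD expRD eb -mulrN expRM_natl elb.
have -> : a^-1 - b^-1 = (b - a) * (a^-1 * b^-1).
  by field; rewrite ?gt_eqF.
rewrite ler_pM ?invr_ge0 ?exprn_ge0 ?invr_ge0 ?(ltW b0)//.
by rewrite expr2 ler_wpM2r ?invr_ge0 ?(ltW b0)// lef_pV2 ?posrE.
Qed.

(** At most 4^d 2^(dk) sites exceed the threshold with probability 2^(-dk) / ((k + 1) ln^2 (k + 1))
    each, and these bounds are summable after the union bound. *)
Lemma field_upper_ae : {ae P, forall w, exists k0, forall k, (k0 <= k)%N ->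
  forall z, (norm1 z <= 2 ^ k)%N ->
  xi z w <= d%:R * k%:R * ln 2 + (ln k.+1%:R + 2 * ln (ln k.+1%:R))}.
Proof.
pose x k : R := d%:R * k%:R * ln 2 + (ln k.+1%:R + 2 * ln (ln k.+1%:R)).
pose E k (b : @box_index d (2 ^ k)) := [set w | x k < xi (box_point b) w].
have mE k b : measurable (@E k b) by exact: measurable_field_gt.
pose A k := [set w | (1 <= count_in (@E k) w)%N].
have : {ae P, forall w, exists k1, forall k, (k1 <= k)%N -> ~ A k w}.
  apply: (@ae_eventually_notin _ _ _ P A (fun k => 4 ^+ d * (ln k%:R)^-1) 2).
  - by move=> k; exact: measurable_count_ge.
  - move=> [|k]; first by rewrite ln0// invr0 mulr0.
    by rewrite mulr_ge0 ?exprn_ge0// invr_ge0 ln_ge0// ler1n.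
  move=> k k2; have := @probability_count_ge _ _ _ P _ (@E k) (mE k) (expR (- x k)) 1 isT.
  move=> /(_ (fun b => probability_field_gt xi_exp (box_point b) (x k))).
  move=> /le_trans; apply; rewrite lee_fin divr1.
  apply: (le_trans (ler_wpM2r (expR_ge0 _) (card_box_index_le k))).
  rewrite -[leLHS]mulrA -expRD /x opprD addNKr -mulrBr ler_wpM2l ?exprn_ge0//.
  exact: inv_ln_telescope.
apply: filterS => w [k1 hk1]; exists k1 => k kk z zk.
have [b zb] := box_point_surj zk.
rewrite leNgt; apply/negP => xz; apply: (hk1 k kk).
by apply: (@count_in_gt0 _ _ _ (@E k) w b); rewrite /E/= -zb.
Qed.

(** Coordinates in [2^k, 2^(k+1)): the cubes of different k are disjoint, so that their maxima are
    independent, and cube k has exactly 2^(dk) points at distance of order 2^k. *)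
Definition cube_point k (f : {ffun 'I_d -> 'I_(2 ^ k)}) : 'rV[int]_d :=
  \row_i (2 ^ k + f i)%N%:Z.

Definition cube k : {fset 'rV[int]_d} := [fset cube_point f | f in {ffun 'I_d -> 'I_(2 ^ k)}]%fset.

Lemma cube_point_inj k : injective (@cube_point k).
Proof.
move=> f g /rowP fg; apply/ffunP => i; apply: val_inj => /=.
by have := fg i; rewrite !mxE; lia.
Qed.

Lemma sum_cube k (c : R) : \sum_(z <- cube k) c = expR (d%:R * k%:R * ln 2) * c.
Proof.
rewrite big_imfset/=; last by move=> f g _ _; exact: cube_point_inj.
rewrite big_enum/= sumr_const card_ffun !card_ord -[LHS]mulr_natl natrX natrX.
by rewrite exp2XE.
Qed.

Lemma norm1_cube k z : z \in cube k -> (norm1 z <= d * 2 ^ k.+1)%N.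
Proof.
move=> /imfsetP[f _ ->]; rewrite /norm1.
apply: (@leq_trans (\sum_(i < d) 2 ^ k.+1)).
  apply: leq_sum => i _; rewrite mxE absz_nat expnS mul2n -addnn leq_add2l.
  exact/ltnW/ltn_ord.
by rewrite sum_nat_const card_ord.
Qed.

Lemma cube_disjoint : (1 <= d)%N ->
  forall k l z, z \in cube k -> z \in cube l -> k = l.
Proof.
move=> d1; pose i0 := Ordinal d1.
have B k z : z \in cube k -> (2 ^ k <= absz (z 0%R i0) < 2 ^ k.+1)%N.
  move=> /imfsetP[f _ ->]; rewrite mxE absz_nat leq_addr/= expnS mul2n -addnn.
  by rewrite ltn_add2l ltn_ord.
move=> k l z /B /andP[k1 k2] /B /andP[l1 l2].
have := leq_ltn_trans k1 l2; have := leq_ltn_trans l1 k2.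
rewrite !ltn_exp2l//; lia.
Qed.

(** The expected number of sites of cube k above the threshold is exactly 1 / (k + 1), so the
    harmonic series controls joint non-occurrence. *)
Lemma field_cube_high_ae : (1 <= d)%N ->
  {ae P, forall w, forall m, exists2 k, (m <= k)%N &
  exists2 z, z \in cube k & d%:R * k%:R * ln 2 + ln k.+1%:R < xi z w}.
Proof.
move=> d1; pose x k : R := d%:R * k%:R * ln 2 + ln k.+1%:R.
have x0 k : 0 <= x k.
  by rewrite addr_ge0 ?mulr_ge0// ln_ge0// ler1n.
pose A k := [set w | exists2 z, z \in cube k & x k < xi z w].
have AE k : A k = ~` [set w | forall z, z \in cube k -> xi z w <= x k].
  apply/seteqP; split => w.
    by move=> [z zk xz] /(_ z zk); rewrite leNgt xz.
  move=> /existsNP[z /not_implyP[zk /negP]]; rewrite -ltNge => xz.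
  by exists z.
apply: (ae_frequently_in (A := A) (K := 0%N)).
  by move=> k; rewrite AE; apply: measurableC; exact: measurable_field_all_le.
move=> m n _.
rewrite (_ : [set w | _] = [set w | forall k, k \in index_iota m n ->
    forall z, z \in cube k -> xi z w <= x k]); last first.
  apply/seteqP; split => w H k.
    by rewrite mem_index_iota => mk; have := H k mk; rewrite AE => /contrapT.
  move=> mk; rewrite AE => nA; apply: nA; apply: H.
  by rewrite mem_index_iota.
rewrite (probability_field_blocks xi_indep xi_exp (cube_disjoint d1) (h := fun k _ => x k))//.
  rewrite lee_fin -sumrN expR_sum 2!big_seq; apply: ler_prod => k _.
  apply/andP; split.
    apply: prodr_ge0 => z _; rewrite subr_ge0 -expR0 ler_expR oppr_le0; exact: x0.
  apply: le_trans (prod_1B_le_expR _) _.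
    by move=> z _; rewrite -expR0 ler_expR oppr_le0; exact: x0.
  rewrite sum_cube (_ : _ * _ = k.+1%:R^-1)//.
  by rewrite -expRD /x opprD addNKr expRN lnK ?posrE.
exact: iota_uniq.
Qed.

(** The expected number of sites above the threshold is 2 ln k, so all stay below it with
    probability at most k^-2, which is at most 1 / (k - 1) - 1 / k. *)
Lemma field_cube_low_ae : (1 <= d)%N ->
  {ae P, forall w, exists k0, forall k, (k0 <= k)%N ->
  exists2 z, z \in cube k & d%:R * k%:R * ln 2 - ln (2 * ln k%:R) < xi z w}.
Proof.
move=> d1; pose x k : R := d%:R * k%:R * ln 2 - ln (2 * ln k%:R).
pose A k := [set w | forall z, z \in cube k -> xi z w <= x k].
have : {ae P, forall w, exists k1, forall k, (k1 <= k)%N -> ~ A k w}.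
  apply: (@ae_eventually_notin _ _ _ P A (fun k => k.-1%:R^-1) 2) => //.
  - by move=> k; exact: measurable_field_all_le.
  move=> k k2.
  have k0 : 0 < k%:R :> R by rewrite ltr0n; lia.
  have lk : 0 < ln k%:R :> R by rewrite ln_gt0// ltr1n.
  have x0 : 0 <= x k.
    rewrite /x subr_ge0 -ler_expR lnK ?posrE ?mulr_gt0// -exp2XE.
    apply: (@le_trans _ _ (2 ^+ k)); last by rewrite -exprM -!natrX ler_nat leq_exp2l// leq_pmulr.
    apply: (@le_trans _ _ (2 * k.-1%:R)).
      rewrite ler_pM2l//; have := @le_ln1Dx R (k.-1%:R).
      rewrite nat1r prednK; last by lia.
      by apply; rewrite (lt_le_trans (ltrN10 R)).
    rewrite -natrX -natrM ler_nat.
    case: k {k0 lk} k2 => // k _; rewrite /= expnS leq_mul2l/=.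
    by apply: ltnW; exact: ltn_expl.
  rewrite (probability_field_all_le xi_indep xi_exp)//.
  rewrite lee_fin; apply: le_trans (prod_1B_le_expR _) _.
    by move=> z _; rewrite -expR0 ler_expR oppr_le0.
  rewrite sum_cube (_ : _ * _ = 2 * ln k%:R); last first.
    by rewrite -expRD /x opprB addrCA subrr addr0 lnK ?posrE ?mulr_gt0.
  rewrite -mulrN expRM_natl expRN lnK ?posrE//.
  case: k k2 k0 {lk x0} => [//|[//|k]] _ k0; rewrite /=.
  have k1 : 0 < k.+1%:R :> R by [].
  rewrite (_ : k.+1%:R^-1 - _ = k.+1%:R^-1 * k.+2%:R^-1 :> R); last first.
    rewrite -[k.+2%:R]natr1; move: (k.+1%:R : R) k1 => a a0.
    by field; rewrite !gt_eqF ?addr_gt0.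
  by rewrite expr2 ler_wpM2r ?invr_ge0// lef_pV2 ?posrE// ler_nat.
apply: filterS => w [k1 hk1]; exists k1 => k kk.
have /existsNP[z /not_implyP[zk /negP]] := hk1 k kk; rewrite -ltNge => xz.
by exists z.
Qed.

End exponential_extremes.

(** * Growth of the total mass *)

Section near_infinity.
Context {R : realType}.
Implicit Types (f : R -> \bar R) (l : R).

Lemma near_ln (Q : set R) : (\forall x \near +oo, Q x) ->
  \forall t \near +oo, Q (ln t).
Proof.
move=> [M [_ MQ]]; exists (expR M); split; first exact: num_real.
move=> t Mt; apply: MQ; rewrite -ltr_expR lnK// posrE.
by rewrite (lt_trans _ Mt)// expR_gt0.
Qed.

Lemma near_ln_ge (M : R) : \forall t \near +oo, M <= ln t.
Proof.
apply: (@near_ln (fun x => M <= x)).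
by apply: nbhs_pinfty_ge; exact: num_real.
Qed.

Lemma near_lnln_ge (M : R) : \forall t \near +oo, M <= ln (ln t).
Proof. by apply: (@near_ln (fun x => M <= ln x)); exact: near_ln_ge. Qed.

Lemma near_lnlnln_ge (M : R) : \forall t \near +oo, M <= ln (ln (ln t)).
Proof. by apply: (@near_ln (fun x => M <= ln (ln x))); exact: near_lnln_ge. Qed.

Lemma near_ln_le (e : R) : 0 < e -> \forall x \near +oo, ln x <= e * x.
Proof.
move=> e0; near=> x.
have x0 : 0 < x by near: x; exact: nbhs_pinfty_gt.
have e2 : 0 < e / 2 by rewrite divr_gt0.
have : ln (e / 2 * x) <= e / 2 * x.
  have := @le_ln1Dx R (e / 2 * x - 1); rewrite addrCA subrr addr0.
  move=> h; apply: le_trans (h _) _; last by rewrite gerBl.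
  by rewrite ltrBrDr addNr mulr_gt0.
rewrite lnM ?posrE// => h.
have : - ln (e / 2) <= e / 2 * x.
  by rewrite [leRHS]mulrC -ler_pdivrMr.
by lra.
Unshelve. all: by end_near. Qed.

Lemma limf_esup_pinfty f l :
  (forall e : R, 0 < e -> \forall t \near +oo, (f t <= (l + e)%:E)%E) ->
  (forall e A : R, 0 < e -> exists2 t, A <= t & ((l - e)%:E <= f t)%E) ->
  limf_esup f (+oo%R : set_system R) = l%:E.
Proof.
move=> up low; apply/eqP; rewrite eq_le; apply/andP; split.
  apply/lee_addgt0Pr => e e0.
  apply: (@le_trans _ _ (ereal_sup (f @` [set t | (f t <= (l + e)%:E)%E]))).
    by apply: ereal_inf_lbound; exists [set t | (f t <= (l + e)%:E)%E] => //; exact: up.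
  by apply: ge_ereal_sup => _ [t ft <-].
apply: le_ereal_inf_tmp => _ [V [M [_ MV]] <-].
apply/lee_addgt0Pr => e e0.
have [t Mt ft] := low e (M + 1) e0.
rewrite -leeBlDr// -EFinB (le_trans ft)//.
apply: ereal_sup_ubound; exists t => //; apply: MV.
by rewrite (lt_le_trans _ Mt)// ltrDl.
Qed.

Lemma limf_einf_pinfty f l :
  (forall e : R, 0 < e -> \forall t \near +oo, ((l - e)%:E <= f t)%E) ->
  (forall e A : R, 0 < e -> exists2 t, A <= t & (f t <= (l + e)%:E)%E) ->
  limf_einf f (+oo%R : set_system R) = l%:E.
Proof.
move=> low up; rewrite /limf_einf (@limf_esup_pinfty _ (- l)) ?EFinN ?oppeK//.
  move=> e e0; have := low e e0; apply: filterS => t.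
  by rewrite leeNl -EFinN opprD opprK.
move=> e A e0; have [t At ft] := up e A e0; exists t => //.
by rewrite leeNr -EFinN opprD !opprK.
Qed.

Lemma exists_exp2_le (x : R) k0 : 2 ^+ k0 <= x ->
  exists2 k, (k0 <= k)%N & 2 ^+ k <= x < 2 ^+ k.+1.
Proof.
move=> k0x; have x1 : 1 <= x.
  by apply: le_trans k0x; apply: exprn_ege1; rewrite ler1n.
pose n := Num.truncn x.
have nx : n%:R <= x by rewrite truncn_le// (le_trans ler01).
have xn : x < n.+1%:R by exact: truncnS_gt.
have n0 : (0 < n)%N by rewrite -ltnS -(ltr_nat R) (le_lt_trans x1).
pose k := trunc_log 2 n.
have kn : (2 ^ k <= n)%N by exact: trunc_logP.
have nk : (n < 2 ^ k.+1)%N by exact: trunc_log_ltn.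
have hx : 2 ^+ k <= x < 2 ^+ k.+1.
  apply/andP; split.
    by rewrite (le_trans _ nx)// -natrX ler_nat.
  by rewrite (lt_le_trans xn)// -natrX ler_nat.
exists k => //.
rewrite leqNgt; apply/negP => kk0.
have /andP[_] := hx; rewrite ltNge => /negP; apply.
by rewrite (le_trans _ k0x)// ler_eXn2l ?ltr1n.
Qed.

(** The upper bound has to be strictly below 1 so that k ln 2 leaves room for lower-order terms; it
    comes from 2 = (3/2)(4/3) and ln (1 + x) <= x. *)
Lemma ln2_bounds : 2^-1 <= ln (2 : R) <= 5 / 6.
Proof.
apply/andP; split.
  rewrite -lerN2 -lnV ?posrE//.
  have := @le_ln1Dx R (- 2^-1); rewrite [1 + _](_ : _ = 2^-1); last by lra.
  by apply; lra.
rewrite (_ : 2 = (1 + 2^-1) * (1 + 3^-1) :> R); last by field.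
rewrite lnM ?posrE ?addr_gt0 ?invr_gt0//.
have := @le_ln1Dx R 2^-1; have := @le_ln1Dx R 3^-1; lra.
Qed.

Lemma fact_le_expn n : (n`! <= n ^ n)%N.
Proof.
elim: n => // n IH; rewrite factS expnS leq_mul2l/=.
rewrite (leq_trans IH)//; case: n {IH} => // n; by rewrite leq_exp2r.
Qed.

End near_infinity.

(** * Lower bounds on the growth rate *)

Section growth_lower_bounds.
Context {R : realType} {d : nat}.
Variables (xi : 'rV[int]_d -> R) (u : R -> 'rV[int]_d -> R).
Hypothesis d1 : (1 <= d)%N.
Hypothesis xi0 : forall z, 0 <= xi z.
Hypothesis solu : nonneg_pam_solution xi u.

(* Run to z in time t / ln t and stay there. *)
Lemma growth_rate_site_ge : \forall t \near +oo, forall z,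
  (norm1 z)%:R * ln (ln t) <= 2 * d%:R * t ->
  (((1 - (ln t)^-1) * xi z - 4 * d%:R)%:E <= growth_rate u t)%E.
Proof.
near=> t; move=> z.
have t0 : 0 < t by [].
have l1 : 1 <= ln t by near: t; exact: near_ln_ge.
have l2 : 4 * d%:R <= ln (ln t).
  by near: t; exact: near_lnln_ge.
have l10 : 0 < ln t by rewrite (lt_le_trans ltr01).
set l := ln t in l1 l2 l10 *; set n := norm1 z => nz.
have dR : 1 <= d%:R :> R by rewrite ler1n.
have nt : n%:R <= t / 2.
  have : n%:R * (4 * d%:R) <= 2 * d%:R * t by apply: le_trans nz; rewrite ler_wpM2l.
  by nra.
pose s := t / l.
have s0 : 0 < s by rewrite divr_gt0.
have st : s <= t by rewrite /s ler_pdivrMr// ler_peMr// ltW.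
have [u0 _ _] := solu.
apply: (growth_rate_ge (z := z) t0) => [y|]; first exact: u0.
apply: le_trans (pam_site_ge xi0 solu z s0 st).
(* The cost of reaching z: n! <= n^n <= (t / 2)^n = (s / 2)^n l^n, and l^n = exp(n lnln t) is at
   most e^(2dt) by the assumption on z. *)
have fn : expR (- (2 * d%:R * t)) <= (s / 2) ^+ n / n`!%:R.
  have f0 : 0 < n`!%:R :> R by rewrite ltr0n fact_gt0.
  rewrite ler_pdivlMr//.
  have sl : n`!%:R <= (s / 2) ^+ n * l ^+ n.
    apply: (@le_trans _ _ (n%:R ^+ n)).
      by rewrite -natrX ler_nat fact_le_expn.
    have sl2 : s / 2 * l = t / 2 by rewrite /s; field; rewrite gt_eqF.
    by rewrite -exprMn sl2 lerXn2r ?nnegrE// divr_ge0// ltW.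
  apply: le_trans (ler_wpM2l (expR_ge0 _) sl) _.
  rewrite mulrCA; apply: ler_piMr.
    by apply: exprn_ge0; rewrite divr_ge0// ltW.
  rewrite expRN ler_pdivrMl ?expR_gt0// mulr1.
  rewrite -[l in X in X <= _](@lnK R)// -expRM_natl ler_expR.
  exact: nz.
rewrite -/n [X in expR X <= _](_ : _ = xi z * (t - s) - 4 * d%:R * t); last first.
  by rewrite /s; field; rewrite gt_eqF.
rewrite (_ : xi z * (t - s) - 4 * d%:R * t =
  (xi z * (t - s) - 2 * d%:R * t) + (- (2 * d%:R * t))); last by ring.
by rewrite expRD ler_wpM2l ?expR_ge0.
Unshelve. all: by end_near. Qed.

Lemma growth_rate_liminf_ge :
  (exists k0, forall k, (k0 <= k)%N -> exists2 z, z \in cube d k &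
     d%:R * k%:R * ln 2 - ln (2 * ln k%:R) < xi z) ->
  exists C : R, \forall t \near +oo,
  ((d%:R * ln t - d.+1%:R * ln (ln (ln t)) - C)%:E <= growth_rate u t)%E.
Proof.
move=> [k0 hk0]; have /andP[ln2l ln2u] := @ln2_bounds R.
(* 4d is the loss in [growth_rate_site_ge], one more d pays for X0 / ln t, and d ln 2 + ln 4 come
   from rounding to the dyadic scale inside [X0]. *)
exists (5 * d%:R + d%:R * ln 2 + ln 4); near=> t.
have t0 : 0 < t by [].
have l1 : 1 <= ln t by near: t; exact: near_ln_ge.
have l2 : 1 <= ln (ln t).
  by near: t; exact: near_lnln_ge.
have l3 : 0 <= ln (ln (ln t)) by rewrite ln_ge0.
have tl : 2 ^+ maxn k0 2 <= t / ln (ln t).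
  rewrite ler_pdivlMr; last exact: lt_le_trans l2.
  rewrite -ler_pdivlMl ?exprn_gt0//.
  have h : ln (ln t) <= ln t by rewrite ltW// ln_sublinear// (lt_le_trans ltr01).
  apply: (le_trans h); near: t; apply: near_ln_le.
  by rewrite invr_gt0 exprn_gt0.
have [k] := exists_exp2_le tl; rewrite geq_max => /andP[kk0 k2] /andP[kt tk].
have [z zk xz] := hk0 k kk0.
have l10 : 0 < ln t by rewrite (lt_le_trans ltr01).
have l20 : 0 < ln (ln t) by rewrite (lt_le_trans ltr01).
have kR : 1 < k%:R :> R by rewrite ltr1n.
have lk0 : 0 < ln k%:R :> R by rewrite ln_gt0.
pose X0 := d%:R * (ln t - ln (ln (ln t)) - ln 2) - (ln 4 + ln (ln (ln t))).
have klow : ln t - ln (ln (ln t)) - ln 2 <= k%:R * ln 2.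
  rewrite -ln_div ?posrE//.
  have : ln (t / ln (ln t)) <= ln (2 ^+ k.+1 : R) by rewrite ler_ln ?posrE ?exprn_gt0 ?divr_gt0// ltW.
  by rewrite exp2E expRK -[k.+1%:R]natr1; lra.
have kup : k%:R <= 2 * ln t.
  have : ln (2 ^+ k : R) <= ln t.
    rewrite ler_ln ?posrE ?exprn_gt0// (le_trans kt)// ler_pdivrMr// ler_peMr// ltW//.
  by rewrite exp2E expRK; have : 0 <= k%:R :> R by []; nra.
have lnk : ln (2 * ln k%:R) <= ln 4 + ln (ln (ln t)).
  rewrite -lnM ?posrE// ler_ln ?posrE ?mulr_gt0//.
  have : ln k%:R <= ln 2 + ln (ln t) :> R.
    by rewrite -lnM ?posrE// ler_ln ?posrE ?mulr_gt0// (lt_trans ltr01).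
  by lra.
have dR : 0 <= d%:R :> R by [].
have Xle : X0 <= xi z by rewrite /X0; nra.
have ln4 : 0 <= ln 4 :> R by rewrite ln_ge0// ler1n.
have X0t : X0 <= d%:R * ln t by rewrite /X0; nra.
have nz : (norm1 z)%:R * ln (ln t) <= 2 * d%:R * t.
  have := norm1_cube zk; rewrite -(ler_nat R) natrM natrX exprS => h.
  have h2 : 2 ^+ k * ln (ln t) <= t by rewrite -ler_pdivlMr.
  apply: (le_trans (ler_wpM2r (ltW l20) h)).
  rewrite (_ : d%:R * (2 * 2 ^+ k) * ln (ln t) = 2 * d%:R * (2 ^+ k * ln (ln t))); last by ring.
  by rewrite ler_wpM2l// mulr_ge0.
have G : forall z, (norm1 z)%:R * ln (ln t) <= 2 * d%:R * t ->
  (((1 - (ln t)^-1) * xi z - 4 * d%:R)%:E <= growth_rate u t)%E.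
  by near: t; exact: growth_rate_site_ge.
apply: le_trans (G z nz); rewrite lee_fin.
have v0 : 0 < (ln t)^-1 by rewrite invr_gt0.
have v1 : (ln t)^-1 <= 1 by rewrite invf_le1.
have h1 : (1 - (ln t)^-1) * X0 <= (1 - (ln t)^-1) * xi z.
  by rewrite ler_wpM2l// subr_ge0.
have h2 : (ln t)^-1 * X0 <= d%:R.
  by rewrite ler_pdivrMl// mulrC.
have : d%:R * ln t - d.+1%:R * ln (ln (ln t)) - (5 * d%:R + d%:R * ln 2 + ln 4) =
  X0 - 5 * d%:R.
  by rewrite /X0 -[d.+1%:R]natr1; ring.
by move=> ->; lra.
Unshelve. all: by end_near. Qed.

Lemma growth_rate_limsup_ge :
  (forall m, exists2 k, (m <= k)%N & exists2 z, z \in cube d k &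
     d%:R * k%:R * ln 2 + ln k.+1%:R < xi z) ->
  exists C : R, forall A : R, exists2 t, A <= t &
  ((d%:R * ln t + ln (ln t) - d%:R * ln (ln (ln t)) - C)%:E <= growth_rate u t)%E.
Proof.
move=> hk; have /andP[ln2l ln2u] := @ln2_bounds R.
exists (5 * d%:R + 1) => A.
have [M [_ MG]] := growth_rate_site_ge.
have [M1 [_ M1G]] : \forall x \near +oo, [/\ A <= x, M < x, expR 1 <= x,
    expR (expR (d%:R + 1)) <= x /\ ln x <= (1 / 8) * x & ln (ln x) <= (1/8) * ln x].
  near=> x; split.
  - by near: x; apply: nbhs_pinfty_ge; exact: num_real.
  - by near: x; apply: nbhs_pinfty_gt; exact: num_real.
  - by near: x; apply: nbhs_pinfty_ge; exact: num_real.
  - split; first by near: x; apply: nbhs_pinfty_ge; exact: num_real.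
    by near: x; apply: near_ln_le.
  - by near: x; apply: (@near_ln R (fun y => ln y <= 1 / 8 * y)); apply: near_ln_le.
have [k Mk [z zk xz]] := hk (Num.truncn M1 + 3)%N.
have Mx : M1 < k.+1%:R.
  by apply: lt_le_trans (truncnS_gt M1) _; rewrite ler_nat ltnS (leq_trans _ Mk)// leq_addr.
have {M1G} [Ax xM xe [xee xl] xll] := M1G _ Mx.
have k3 : 3 <= k%:R :> R by rewrite ler_nat (leq_trans _ Mk)// leq_addl.
have kx : k%:R = k.+1%:R - 1 :> R by rewrite -[k.+1%:R]natr1 addrK.
set x : R := k.+1%:R in Ax xM xe xee xl xll kx xz Mx.
have x0 : 0 < x by rewrite (lt_le_trans _ xe)// expR_gt0.
have lx1 : 1 <= ln x by rewrite -ler_expR lnK ?posrE.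
have lx0 : 0 < ln x by lra.
have llx0 : 0 <= ln (ln x) by rewrite ln_ge0.
(* The time at which cube k becomes reachable: its sites have norm at most d 2^(k+1), and lnln t <=
   ln x. *)
pose t := 2 ^+ k * ln x.
have p0 : 0 < 2 ^+ k :> R by rewrite exprn_gt0.
have t0 : 0 < t by rewrite mulr_gt0.
have kt : x <= t.
  rewrite /t -[leLHS]mulr1 ler_pM// /x -natrX ler_nat; exact: ltn_expl.
have lt : ln t = k%:R * ln 2 + ln (ln x).
  by rewrite /t lnM ?posrE// exp2E expRK.
have x4 : 4 <= x by lra.
have h5 : (x - 1) * 2^-1 <= (x - 1) * ln 2 by rewrite ler_wpM2l//; lra.
have h6 : (x - 1) * ln 2 <= (x - 1) * (5 / 6) by rewrite ler_wpM2l//; lra.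
have lt1 : x / 8 <= ln t by rewrite lt kx; lra.
have ltx : ln t <= x by rewrite lt kx; lra.
have ltlx : ln x <= ln t by apply: le_trans xl _; lra.
have l10 : 0 < ln t by lra.
have l1 : 1 <= ln t by lra.
have l2x : ln (ln t) <= ln x by rewrite ler_ln ?posrE.
have lD : d%:R + 1 <= ln (ln x).
  rewrite -ler_expR lnK ?posrE// -ler_expR lnK ?posrE//.
have l2D : d%:R + 1 <= ln (ln t).
  by apply: (le_trans lD); rewrite ler_ln ?posrE.
exists t; first exact: le_trans Ax kt.
have l20 : 0 < ln (ln t) by rewrite (lt_le_trans _ l2D)// ltr_wpDl.
have nz : (norm1 z)%:R * ln (ln t) <= 2 * d%:R * t.
  have := norm1_cube zk; rewrite -(ler_nat R) natrM natrX exprS => h.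
  apply: (le_trans (ler_pM _ _ h l2x)) => //; first exact: ltW.
  by rewrite /t le_eqVlt; apply/orP; left; apply/eqP; ring.
apply: le_trans (MG t (lt_le_trans xM kt) z nz); rewrite lee_fin.
pose X := d%:R * k%:R * ln 2 + ln x.
have v0 : 0 < (ln t)^-1 by rewrite invr_gt0.
have v1 : (ln t)^-1 <= 1 by rewrite invf_le1.
have h1 : (1 - (ln t)^-1) * X <= (1 - (ln t)^-1) * xi z.
  by rewrite ler_wpM2l ?subr_ge0// ltW.
have dR : 0 <= d%:R :> R by [].
have h2 : (ln t)^-1 * X <= d%:R + 1.
  by rewrite ler_pdivrMl// /X mulrDr mulr1 lt; nra.
(* What remains is ln x - d lnln x >= lnln t - d lnlnln t, that is, y - d ln y is larger at ln x
   than at lnln t; this holds because lnln t >= d. *)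
have h3 : ln (ln x) - ln (ln (ln t)) <= (ln x - ln (ln t)) / ln (ln t).
  rewrite -ln_div ?posrE//.
  have := @le_ln1Dx R (ln x / ln (ln t) - 1); rewrite addrCA subrr addr0.
  rewrite ltrBrDr addNr divr_gt0// => /(_ isT) /le_trans; apply.
  by rewrite mulrBl divff// gt_eqF.
have h4 : d%:R * (ln (ln x) - ln (ln (ln t))) <= ln x - ln (ln t).
  apply: (le_trans (ler_wpM2l dR h3)).
  rewrite mulrCA ler_piMr ?subr_ge0// ler_pdivrMr// mul1r.
  by rewrite (le_trans _ l2D)// lerDl.
by rewrite /X in h1 h2; rewrite lt in h1 h2 h4 *; nra.
Unshelve. all: by end_near. Qed.

End growth_lower_bounds.

Section dyadic.
Context {R : realType}.

Lemma linear_le_exp2 (e : R) : 0 < e ->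
  exists2 C : R, 0 <= C & forall k, k%:R <= C + e * 2 ^+ k.
Proof.
move=> e0; exists `|2 + 2 * ln (e / 2)| => // k.
have /andP[ln2l _] := @ln2_bounds R.
have e2 : 0 < e / 2 by rewrite divr_gt0.
have := @expR_ge1Dx R (k%:R * ln 2 + ln (e / 2)).
rewrite expRD -exp2E lnK ?posrE//.
have := ler_norm (- (2 + 2 * ln (e / 2))); rewrite normrN.
have : k%:R * 2^-1 <= k%:R * ln 2 :> R by rewrite ler_wpM2l.
lra.
Qed.

(** The least admissible k. Unless it is [k0], 2^k < 2n, so the envelope at level k is controlled by
    n itself. *)
Lemma exists_exp2_ge (n k0 : nat) : exists k, [/\ (k0 <= k)%N, (n <= 2 ^ k)%N &
  k = k0 \/ (k0 < k)%N /\ (2 ^ k.-1 < n)%N].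
Proof.
have ex : exists k, (k0 <= k)%N && (n <= 2 ^ k)%N.
  exists (k0 + n)%N; rewrite leq_addr/=.
  by rewrite (leq_trans (ltnW (ltn_expl n (ltnSn 1))))// leq_exp2l// leq_addl.
case: (ex_minnP ex) => k /andP[k0k nk] kmin; exists k; split => //.
have [->|kk0] := eqVneq k k0; [by left|right].
have k0k' : (k0 < k)%N by rewrite ltn_neqAle eq_sym kk0.
split => //; rewrite ltnNge; apply/negP => nk1.
have : (k <= k.-1)%N.
  apply: kmin; rewrite nk1 andbT; move: k0k'; clear; case: k => //.
by move: k0k'; clear; case: k => // k _ /=; rewrite ltnn.
Qed.

Definition log_correction (k : nat) : R := ln k.+1%:R + 2 * ln (ln k.+1%:R).

Lemma lnD_le (x : R) (i : nat) : 1 <= x -> ln (x + i%:R) <= ln x + i%:R.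
Proof.
move=> x1; have x0 : 0 < x by lra.
have i0 : 0 <= i%:R :> R by [].
apply: (@le_trans _ _ (ln (x * (1 + i%:R)))).
  by rewrite ler_ln ?posrE ?mulr_gt0 ?ltr_wpDr//; nra.
rewrite lnM ?posrE ?ltr_wpDr// lerD2l.
by apply: le_ln1Dx; lra.
Qed.

Lemma ln_succ_ge1 k : (3 <= k)%N -> 1 <= ln k.+1%:R :> R.
Proof.
move=> k3; have /andP[ln2l _] := @ln2_bounds R.
have : ln (2 * 2) <= ln k.+1%:R :> R.
  by rewrite ler_ln ?posrE// -natrM ler_nat.
rewrite lnM ?posrE//; lra.
Qed.

Lemma log_correctionD_le k (i : nat) : (3 <= k)%N ->
  log_correction (k + i) <= log_correction k + 3 * i%:R.
Proof.
move=> k3; have l1 := ln_succ_ge1 k3; rewrite /log_correction.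
have h1 : ln (k + i).+1%:R <= ln k.+1%:R + i%:R :> R.
  by rewrite -addSn natrD; apply: lnD_le; rewrite ler1n.
have h2 : ln (ln (k + i).+1%:R) <= ln (ln k.+1%:R) + i%:R :> R.
  apply: le_trans (lnD_le _ l1); rewrite ler_ln ?posrE//.
    by apply: lt_le_trans (ln_succ_ge1 (leq_trans k3 (leq_addr i k))).
  by rewrite ltr_wpDr// (lt_le_trans _ l1).
lra.
Qed.

Lemma log_correction_le k l : (3 <= k <= l)%N ->
  log_correction k <= log_correction l.
Proof.
move=> /andP[k3 kl]; have l1 := ln_succ_ge1 k3; rewrite /log_correction.
have h1 : ln k.+1%:R <= ln l.+1%:R :> R.
  by rewrite ler_ln ?posrE// ler_nat ltnS.
rewrite lerD// ler_pM2l// ler_ln ?posrE//; lra.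
Qed.

Lemma log_correction_le_ln k : (3 <= k)%N ->
  0 <= log_correction k <= 3 * ln k.+1%:R.
Proof.
move=> k3; have l1 := ln_succ_ge1 k3; rewrite /log_correction.
have := ln_ge0 l1; have := @ln_sublinear R (ln k.+1%:R).
have : 0 < ln k.+1%:R :> R by lra.
move=> l0 /(_ l0); lra.
Qed.

End dyadic.

(** * Upper bound for all large times *)

Definition upper_envelope {R : realType} {d : nat} (xi : 'rV[int]_d -> R) :=
  exists k0, forall k, (k0 <= k)%N -> forall z, (norm1 z <= 2 ^ k)%N ->
    xi z <= d%:R * k%:R * ln 2 + log_correction k.

Section growth_upper_bounds.
Context {R : realType} {d : nat}.
Variables (xi : 'rV[int]_d -> R) (u : R -> 'rV[int]_d -> R).
Hypothesis xi0 : forall z, 0 <= xi z.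
Hypothesis solu : nonneg_pam_solution xi u.
Hypothesis xi_upper : upper_envelope xi.

Lemma upper_envelope_from3 : exists2 k0, (3 <= k0)%N & forall k, (k0 <= k)%N ->
  forall z, (norm1 z <= 2 ^ k)%N ->
  xi z <= d%:R * k%:R * ln 2 + log_correction k.
Proof.
have [k0 h] := xi_upper; exists (maxn k0 3); first exact: leq_maxr.
by move=> k; rewrite geq_max => /andP[kk0 _]; exact: h.
Qed.

Lemma upper_envelope_sublinear (c : R) : 0 < c ->
  exists A : R, forall z, xi z <= A + c * (norm1 z)%:R.
Proof.
move=> c0; have [k0 k03 hk0] := upper_envelope_from3; have /andP[ln2l ln2u] := @ln2_bounds R.
have d0 : 0 <= d%:R :> R by [].
have e0 : 0 < c / (2 * (d%:R + 3)).
  by rewrite divr_gt0// mulr_gt0// ltr_wpDl.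
have [C C0 hC] := linear_le_exp2 e0.
exists ((d%:R + 3) * (k0%:R + C)) => z.
have [k [kk0 zk kz]] := exists_exp2_ge (norm1 z) k0.
have k3 := leq_trans k03 kk0.
have h1 : xi z <= (d%:R + 3) * k%:R.
  apply: (le_trans (hk0 k kk0 z zk)).
  have /andP[_ h2] := @log_correction_le_ln R k k3.
  have h3 : ln k.+1%:R <= k%:R :> R.
    by rewrite -nat1r; apply: le_ln1Dx; rewrite (lt_le_trans (ltrN10 R)).
  have : d%:R * k%:R * ln 2 <= d%:R * k%:R * 1 :> R by rewrite ler_wpM2l ?mulr_ge0//; lra.
  lra.
apply: (le_trans h1).
have [->|[k0k k1z]] := kz.
  rewrite ler_wpDr ?mulr_ge0 ?(ltW c0)//.
  by rewrite ler_wpM2l ?addr_ge0// lerDl.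
have : 2 ^+ k <= 2 * (norm1 z)%:R :> R.
  rewrite -natrX -natrM ler_nat.
  case: (k) k0k k1z => // j _ /=; rewrite expnS leq_mul2l/=; exact: ltnW.
move=> h4; have := hC k => h5.
have h6 : (d%:R + 3) * k%:R <= (d%:R + 3) * (C + c / (2 * (d%:R + 3)) * 2 ^+ k).
  by rewrite ler_wpM2l// addr_ge0.
apply: (le_trans h6).
have -> : (d%:R + 3) * (C + c / (2 * (d%:R + 3)) * 2 ^+ k) =
    (d%:R + 3) * C + c / 2 * 2 ^+ k.
  by field; rewrite gt_eqF// ltr_wpDl.
have : 0 <= (d%:R + 3) * k0%:R :> R by rewrite mulr_ge0// addr_ge0.
nra.
Qed.

Lemma growth_rate_limsup_le : exists C : R, \forall t \near +oo,
  (growth_rate u t <= (d%:R * ln t + ln (ln t) + 2 * ln (ln (ln t)) + C)%:E)%E.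
Proof.
have [k0 k03 hk0] := upper_envelope_from3; have /andP[ln2l ln2u] := @ln2_bounds R.
have d0 : 0 <= d%:R :> R by [].
(* Going from scale 2^K to 2^(K+i) raises the envelope by at most (d + 3) i, while |z| / 2t is then
   at least 2^i / 4; C1 is the largest deficit. *)
have [C1 C10 hC1] : exists2 C : R, 0 <= C & forall i,
    (d%:R + 3) * i%:R <= C + 4^-1 * 2 ^+ i.
  have e0 : 0 < 4^-1 / (d%:R + 3) :> R by rewrite divr_gt0// ltr_wpDl.
  have [C C0 hC] := linear_le_exp2 e0.
  exists ((d%:R + 3) * C); first by rewrite mulr_ge0// addr_ge0.
  move=> i; have : (d%:R + 3) * i%:R <= (d%:R + 3) * (C + 4^-1 / (d%:R + 3) * 2 ^+ i) :> R.
    by rewrite ler_wpM2l// addr_ge0.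
  move=> /le_trans; apply; rewrite le_eqVlt; apply/orP; left; apply/eqP.
  by field; rewrite gt_eqF// ltr_wpDl.
(* The first d pays for K = k + 1 in place of k, the next ln 5 terms for K + 1 <= 5 ln t in
   [log_correction], and the last d ln 5 for summing e^(-|z| / 2) over the lattice. *)
exists (d%:R + C1 + 2 * d%:R * (expR 1 - 1) + ln 5 + 2 * ln (1 + ln 5) + d%:R * ln 5).
near=> t.
have t0 : 0 < t by [].
have t1 : 1 <= t by near: t; apply: nbhs_pinfty_ge; exact: num_real.
have l1 : 1 <= ln t by near: t; exact: near_ln_ge.
have l2 : 1 <= ln (ln t) by near: t; exact: near_lnln_ge.
have tl : 2 ^+ k0 <= t by near: t; apply: nbhs_pinfty_ge; exact: num_real.
have [k kk0 /andP[kt tk]] := exists_exp2_le tl.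
set K := k.+1; have K3 : (3 <= K)%N by rewrite (leq_trans k03)// ltnW// ltnS.
have e1 : 0 <= expR 1 - 1 :> R by rewrite subr_ge0 -[leLHS]expR0 ler_expR.
pose lam := d%:R * K%:R * ln 2 + log_correction K + C1 + 2 * d%:R * (expR 1 - 1).
have de0 : 0 <= 2 * d%:R * (expR 1 - 1) :> R by rewrite !mulr_ge0.
have cond z : xi z + 2 * d%:R *
    (expR ((norm1 z)%:R - (norm1 z).-1%:R) - 1) <= lam + (norm1 z)%:R / (2 * t).
  have h1 : 2 * d%:R * (expR ((norm1 z)%:R - (norm1 z).-1%:R) - 1) <=
      2 * d%:R * (expR 1 - 1) :> R.
    rewrite ler_wpM2l ?mulr_ge0// lerD2r ler_expR.
    by case: (norm1 z) => [|n] /=; rewrite ?subrr// -natr1; lra.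
  have [j [Kj zj hj]] := exists_exp2_ge (norm1 z) K.
  have kj : (k0 <= j)%N by rewrite (leq_trans _ Kj)// ltnW// ltnS.
  have xz := hk0 j kj z zj.
  have zt : 0 <= (norm1 z)%:R / (2 * t) by rewrite divr_ge0// mulr_ge0// ltW.
  case: hj => [jK|[Kj' jz]].
    by rewrite jK in xz; rewrite /lam; lra.
  have [i ij] : exists i, j = (K + i)%N by exists (j - K)%N; rewrite subnKC.
  have h2 := @log_correctionD_le R K i K3.
  have h3 : 4^-1 * 2 ^+ i <= (norm1 z)%:R / (2 * t).
    rewrite ler_pdivlMr ?mulr_gt0//.
    have h4 : 2 ^+ j <= 2 * (norm1 z)%:R :> R.
      rewrite -natrX -natrM ler_nat.
      case: (j) Kj' jz => // j' _ /=; rewrite expnS leq_mul2l/=; exact: ltnW.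
    have h5 : 2 ^+ i * t <= 2 ^+ j.
      by rewrite ij addnC exprD ler_wpM2l ?exprn_ge0// ltW.
    lra.
  rewrite ij natrD in xz.
  have h6 : d%:R * i%:R * ln 2 <= d%:R * i%:R :> R.
    by rewrite ler_piMr ?mulr_ge0//; lra.
  have := hC1 i; rewrite /lam; lra.
have Snd n : n%:R <= n.+1%:R :> R by rewrite ler_nat.
have h := @pam_le R d xi u xi0 solu upper_envelope_sublinear t lam (fun n => n%:R) t0 erefl Snd cond.
have [u0 _ _] := solu.
have a0 : 0 < 2^-1 :> R by [].
have h' y : u t y <= expR (lam * t - 2^-1 * (norm1 y)%:R).
  by have := h y; rewrite [(norm1 y)%:R / 2]mulrC.
apply: (le_trans (@growth_rate_le R d u t lam 2^-1 t0 a0 (fun y => u0 t y t0) h')).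
rewrite lee_fin.
have -> : 1 + 2 / 2^-1 = 5 :> R by rewrite invrK; lra.
have h5 : d%:R * ln 5 / t <= d%:R * ln 5.
  by rewrite ler_pdivrMr// ler_peMr// mulr_ge0// ln_ge0// ler1n.
have kl : k%:R * ln 2 <= ln t.
  have : ln (2 ^+ k : R) <= ln t by rewrite ler_ln ?posrE ?exprn_gt0.
  by rewrite exp2E expRK.
have Kl : d%:R * K%:R * ln 2 <= d%:R * ln t + d%:R.
  rewrite /K -[k.+1%:R]natr1 -mulrA -[X in _ <= _ + X]mulr1 -mulrDr ler_wpM2l//; lra.
have K5 : K.+1%:R <= 5 * ln t.
  rewrite /K -[k.+2%:R]natr1 -[k.+1%:R]natr1.
  have : k%:R * 2^-1 <= k%:R * ln 2 :> R by rewrite ler_wpM2l.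
  lra.
have l0 : 0 < ln t by lra.
have l20 : 0 < ln (ln t) by lra.
have ln5 : 0 <= ln 5 :> R by rewrite ln_ge0// ler1n.
have lK : ln K.+1%:R <= ln 5 + ln (ln t).
  by rewrite -lnM ?posrE// ler_ln ?posrE ?mulr_gt0.
have lK0 : 0 < ln K.+1%:R :> R by rewrite (lt_le_trans ltr01)// ln_succ_ge1.
have llK : ln (ln K.+1%:R) <= ln (1 + ln 5) + ln (ln (ln t)).
  have l50 : 0 < 1 + ln 5 :> R by rewrite ltr_wpDr.
  have q : ln 5 + ln (ln t) <= (1 + ln 5) * ln (ln t).
    by rewrite mulrDl mul1r addrC lerD2l ler_peMr.
  by rewrite -lnM ?posrE// ler_ln ?posrE ?mulr_gt0// (le_trans lK).
rewrite /lam /log_correction; lra.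
Unshelve. all: by end_near. Qed.

End growth_upper_bounds.

(** * The radial profile and the upper bound along t = 2^(k^2) *)

Section profile.
Context {R : realType} {d : nat}.
Variables (xi : 'rV[int]_d -> R) (n : nat) (theta p : R).
Hypothesis p0 : 0 <= p.

Definition high_shell (j : nat) : bool :=
  [exists b : @box_index d n, (norm1 (box_point b) == j) && (theta < xi (box_point b))].

Definition high_sites : nat := #|[pred b : @box_index d n | theta < xi (box_point b)]|.

Definition profile (r : nat) : R := \sum_(j < r) p * (~~ high_shell j.+1)%:R.

Lemma profile0 : profile 0 = 0.
Proof. by rewrite /profile big_ord0. Qed.

Lemma profileS r : profile r.+1 = profile r + p * (~~ high_shell r.+1)%:R.
Proof. by rewrite /profile big_ord_recr. Qed.

Lemma profile_nd r : profile r <= profile r.+1.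
Proof. by rewrite profileS lerDl mulr_ge0. Qed.

Lemma profile_ge0 r : 0 <= profile r.
Proof. by apply: sumr_ge0 => j _; rewrite mulr_ge0. Qed.

Lemma profile_step r : profile r - profile r.-1 <= p.
Proof.
case: r => [|r] /=; first by rewrite subrr.
rewrite profileS addrC addKr; case: high_shell; rewrite ?mulr0 ?mulr1//.
Qed.

Lemma profile_step_high r : (r == 0)%N || high_shell r ->
  profile r - profile r.-1 = 0.
Proof.
case: r => [|r] /=; first by rewrite subrr.
by move=> h; rewrite profileS addrC addKr h mulr0.
Qed.

(** Each high site lies on a single sphere, so double counting bounds the flat spheres by the high
    sites. *)
Lemma sum_high_shell_le r : (\sum_(j < r) high_shell j.+1 <= high_sites)%N.
Proof.
pose B (b : @box_index d n) (j : nat) : bool :=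
  (norm1 (box_point b) == j) && (theta < xi (box_point b)).
apply: (@leq_trans (\sum_(j < r) \sum_(b : @box_index d n) B b j.+1)).
  apply: leq_sum => j _; have [/existsP[b bj]|//] := boolP (high_shell j.+1).
  by rewrite (bigD1 b)//= {1}/B bj leq_addr.
rewrite exchange_big/= /high_sites -sum1_card [leqRHS]big_mkcond/=.
apply: leq_sum => b _; rewrite inE /B.
case: ifP => bt; last first.
  by rewrite big1// => j _; rewrite andbF.
have [|br] := leqP (norm1 (box_point b)) r; last first.
  by rewrite big1// => j _; rewrite andbT; case: eqP => // bj; have := ltn_ord j; lia.
case: (norm1 (box_point b)) => [|m] mr; first by rewrite big1.
rewrite (bigD1 (Ordinal mr))//= eqxx big1// => j jm; rewrite andbT.
case: eqP => // -[mj]; move: jm; rewrite -val_eqE/= mj eqxx//.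
Qed.

Lemma profile_ge r : p * (r%:R - high_sites%:R) <= profile r.
Proof.
rewrite /profile -mulr_sumr ler_wpM2l//.
have -> : \sum_(j < r) (~~ high_shell j.+1)%:R =
    r%:R - (\sum_(j < r) high_shell j.+1)%N%:R :> R.
  rewrite natr_sum; apply/eqP; rewrite eq_sym subr_eq -big_split/=.
  rewrite (eq_bigr (fun=> 1)) => [|j _]; last by case: high_shell; rewrite ?addr0 ?add0r.
  by rewrite sumr_const card_ord.
by rewrite lerB// ler_nat sum_high_shell_le.
Qed.

End profile.

Lemma square_facts k : (4 <= k)%N ->
  [/\ (k * k.-1 + k = k * k)%N, (k * k + k = k * k.+1)%N, (3 <= k * k.-1)%N,
     (k <= k * k.-1)%N & (16 <= k * k)%N].
Proof. by case: k => // k k3; split; nia. Qed.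

Section growth_liminf_upper_bound.
Context {R : realType} {d : nat}.
Variables (xi : 'rV[int]_d -> R) (u : R -> 'rV[int]_d -> R).
Hypothesis d1 : (1 <= d)%N.
Hypothesis xi0 : forall z, 0 <= xi z.
Hypothesis solu : nonneg_pam_solution xi u.
Hypothesis xi_upper : upper_envelope xi.

(** With t = 2^(k^2) this is the growth per unit distance of S(r) / 2t when S increases by ln k. An
    increment ln k makes the jump term at most 2dk. *)
Definition slope (k : nat) : R := ln k%:R / (2 * 2 ^+ (k * k)).

Definition base_level (k : nat) : R :=
  d%:R * ln (3 / slope k) + ln 2 - ln (ln k.+1%:R).

(** (d - 1/2) ln t: far enough below d ln t to leave slack of order k^2 for the jump term, yet
    exceeded by only about 2^(k^2/2 + dk) sites within distance t 2^k. *)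
Definition site_threshold (k : nat) : R := (d%:R - 2^-1) * (k * k)%:R * ln 2.

Hypothesis sparse : exists k0, forall k, (k0 <= k)%N ->
  (high_sites xi (2 ^ (k * k.+1)) (site_threshold k) <= 2 ^ (k * k.-1))%N.

Hypothesis low : forall m, exists2 k, (m <= k)%N &
  forall z, (2 ^ (k * k.-1) < norm1 z <= 2 ^ (k * k.+1))%N ->
  xi z <= base_level k + slope k * (norm1 z)%:R.

Lemma base_levelE k : (4 <= k)%N -> base_level k =
  d%:R * (k * k)%:R * ln 2 + d%:R * ln 6 - d%:R * ln (ln k%:R) + ln 2 - ln (ln k.+1%:R).
Proof.
case: k => // k k3; have l0 : 0 < ln k.+1%:R :> R.
  by apply: lt_le_trans (ln_succ_ge1 k3).
rewrite /base_level (_ : 3 / slope k.+1 = 6 * 2 ^+ (k.+1 * k.+1) / ln k.+1%:R); last first.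
  by rewrite /slope; field; rewrite !gt_eqF// exprn_gt0.
by rewrite ln_div ?posrE ?mulr_gt0 ?exprn_gt0// lnM ?posrE ?exprn_gt0// exp2E expRK; ring.
Qed.

Let correction k : R := d%:R * ln (ln k%:R) + ln (ln k.+1%:R) + log_correction (k * k).

(** The correction consists of logarithms of k, whereas moving in by a factor 2^k lowers the
    envelope by d k ln 2 >= k / 2. *)
Let correction_le : exists K, forall k, (K <= k)%N -> correction k <= k%:R / 2.
Proof.
have e0 : 0 < (4 * (d%:R + 7))^-1 :> R by rewrite invr_gt0 mulr_gt0// ltr_wpDl.
have [M [_ MG]] := near_ln_le e0.
exists (maxn (Num.truncn M).+1 4) => k; rewrite geq_max => /andP[Mk k4].
have kM : M < k.+1%:R.
  by apply: lt_le_trans (truncnS_gt M) _; rewrite ler_nat (leq_trans Mk).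
have k1 : 1 <= k%:R :> R by rewrite ler1n; lia.
have k3 : (3 <= k.-1)%N by lia.
have lk : 1 <= ln k%:R :> R by have := @ln_succ_ge1 R _ k3; rewrite prednK//; lia.
have lk1 : 1 <= ln k.+1%:R :> R by apply: ln_succ_ge1; lia.
have kk : (3 <= k * k)%N by nia.
have /andP[_ h1] := @log_correction_le_ln R _ kk.
have lkk : ln k%:R <= ln k.+1%:R :> R.
  by rewrite ler_ln ?posrE ?ler_nat// ltr0n; lia.
have h2 : ln (k * k).+1%:R <= 2 * ln k.+1%:R :> R.
  rewrite mulr_natl mulr2n -lnM ?posrE// ler_ln ?posrE ?mulr_gt0// -natrM ler_nat; nia.
have h3 : ln (ln k%:R) <= ln k%:R :> R by rewrite ltW// ln_sublinear//; lra.
have h4 : ln (ln k.+1%:R) <= ln k.+1%:R :> R by rewrite ltW// ln_sublinear//; lra.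
have h5 : (d%:R + 7) * ln k.+1%:R <= k.+1%:R / 4 :> R.
  have := MG _ kM => h; apply: le_trans (ler_wpM2l _ h) _; first by rewrite addr_ge0.
  by rewrite le_eqVlt; apply/orP; left; apply/eqP; field; rewrite gt_eqF// ltr_wpDl.
have h6 : d%:R * ln (ln k%:R) <= d%:R * ln k.+1%:R :> R by rewrite ler_wpM2l//; lra.
rewrite -[k.+1%:R]natr1 in h5 *; rewrite /correction.
rewrite -[k.+1%:R]natr1 in h1 h2 h3 h4 h6 lk1 lkk *; lra.
Qed.

(** The coefficient collects the costs at distance about t 2^i with i > k: d i from the envelope, 3i
    from [log_correctionD_le], 2d i for the jump term and at most i for [correction]. *)
Let exp2_dominates : exists K, forall i, (K <= i)%N ->
  (3 * d%:R + 4) * i%:R <= 4^-1 * 2 ^+ i :> R.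
Proof.
have e0 : 0 < (8 * (3 * d%:R + 4))^-1 :> R by rewrite invr_gt0 mulr_gt0// ltr_wpDl ?mulr_ge0.
have [C C0 hC] := linear_le_exp2 e0.
exists (Num.truncn (2 * C)).+1 => i Ki.
have Ci : 2 * C <= i%:R.
  by apply/ltW/(lt_le_trans (truncnS_gt _)); rewrite ler_nat.
have h := hC i; have d0 : 0 <= d%:R :> R by [].
have c0 : 0 < 3 * d%:R + 4 :> R by lra.
move: c0 h; set c : R := 3 * d%:R + 4; move=> c0 h.
have h2 : i%:R <= (4 * c)^-1 * 2 ^+ i.
  rewrite (_ : (4 * c)^-1 = 2 * (8 * c)^-1); last by field; rewrite gt_eqF.
  by rewrite -mulrA; move: h; set y := _^-1 * _; lra.
apply: le_trans (ler_wpM2l (ltW c0) h2) _.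
by rewrite le_eqVlt; apply/orP; left; apply/eqP; field; rewrite gt_eqF.
Qed.

Let base_level_ge k : (4 <= k)%N ->
  d%:R * (k * k)%:R * ln 2 - (correction k - log_correction (k * k)) <=
  base_level k.
Proof.
move=> k4; rewrite base_levelE// /correction.
have /andP[ln2l _] := @ln2_bounds R.
have : 0 <= d%:R * ln 6 :> R by rewrite mulr_ge0// ln_ge0// ler1n.
lra.
Qed.

Let half_le_ln2 (x : R) : 0 <= x -> x / 2 <= x * ln 2.
Proof. by move=> x0; have /andP[ln2l _] := @ln2_bounds R; rewrite ler_wpM2l. Qed.

Let ln2_le1 (x : R) : 0 <= x -> x * ln 2 <= x.
Proof. by move=> x0; have /andP[_ ln2u] := @ln2_bounds R; rewrite ler_piMr//; lra. Qed.

Lemma inner_sites_le : exists K, forall k, (K <= k)%N -> forall z,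
  (norm1 z <= 2 ^ (k * k.-1))%N -> xi z <= base_level k.
Proof.
have [k0 k03 hk0] := upper_envelope_from3 xi_upper.
have [k2 hk2] := correction_le.
exists (k0 + k2 + 4)%N => k kK z zk.
have [kk0 kk2 k4] : [/\ (k0 <= k)%N, (k2 <= k)%N & (4 <= k)%N] by split; lia.
have [lokk kkhi k3k kkk _] := square_facts k4.
have klo : (k0 <= k * k.-1)%N by exact: leq_trans kk0 kkk.
apply: (le_trans (hk0 _ klo z zk)); apply: le_trans (base_level_ge k4).
have h1 : log_correction (k * k.-1) <= log_correction (k * k) :> R.
  by apply: log_correction_le; rewrite k3k/= -lokk leq_addr.
have h2 : (k * k.-1)%:R = (k * k)%:R - k%:R :> R by rewrite -lokk natrD addrK.
have h3 : k%:R / 2 <= d%:R * k%:R * ln 2 :> R.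
  apply: (@le_trans _ _ (k%:R * ln 2)); first exact: half_le_ln2.
  by rewrite -mulrA ler_peMl ?ler1n// mulr_ge0// ln_ge0// ler1n.
have := hk2 k kk2; rewrite h2; lra.
Qed.

Lemma outer_sites_le : exists K, forall k, (K <= k)%N -> forall z,
  (2 ^ (k * k.+1) < norm1 z)%N ->
  xi z + 2 * d%:R * k%:R <= base_level k + slope k * (norm1 z)%:R.
Proof.
have [k0 k03 hk0] := upper_envelope_from3 xi_upper.
have [k2 hk2] := correction_le; have [k4 hk4] := exp2_dominates.
exists (k0 + k2 + k4 + 4)%N => k kK z nz.
have [kk0 kk2 kk4 k44] : [/\ (k0 <= k)%N, (k2 <= k)%N, (k4 <= k)%N & (4 <= k)%N].
  by split; lia.
have [_ kkhi _ _ kk16] := square_facts k44.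
have kk3 : (3 <= k * k)%N := leq_trans (isT : (3 <= 16)%N) kk16.
have [j [kj zj hj]] := exists_exp2_ge (norm1 z) (k * k.+1).
case: hj => [jE|[kj' jz]]; first by move: nz; rewrite -jE ltnNge zj.
have [i ij] : exists i, j = (k * k + i)%N.
  by exists (j - k * k)%N; rewrite subnKC// (leq_trans _ kj)// -kkhi leq_addr.
have ki : (k < i)%N by move: kj'; rewrite ij -kkhi ltn_add2l.
have kjj : (k0 <= j)%N.
  by rewrite (leq_trans kk0)// ij (leq_trans (ltnW ki))// leq_addl.
have xz := hk0 j kjj z zj.
have h1 := @log_correctionD_le R (k * k) i kk3; rewrite -ij in h1.
have h2 : 2 ^+ j <= 2 * (norm1 z)%:R :> R.
  rewrite -natrX -natrM ler_nat.
  case: (j) kj' jz => // j' _ /=; rewrite expnS leq_mul2l/=; exact: ltnW.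
have l1 : 1 <= ln k%:R :> R.
  have k3 : (3 <= k.-1)%N by rewrite -ltnS prednK// (leq_trans _ k44).
  by have := @ln_succ_ge1 R _ k3; rewrite prednK// (leq_trans _ k44).
have h3 : 4^-1 * 2 ^+ i <= slope k * (norm1 z)%:R.
  have t0 : 0 < 2 ^+ (k * k) :> R by rewrite exprn_gt0.
  rewrite /slope mulrAC ler_pdivlMr ?mulr_gt0//.
  apply: (@le_trans _ _ (norm1 z)%:R); last by rewrite ler_peMl.
  rewrite ij exprD in h2; lra.
have h4 := hk4 i (leq_trans kk4 (ltnW ki)).
have h5 : d%:R * i%:R * ln 2 <= d%:R * i%:R :> R by rewrite ln2_le1// mulr_ge0.
have h6 : 2 * d%:R * k%:R <= 2 * d%:R * i%:R :> R.
  by rewrite ler_wpM2l ?mulr_ge0// ler_nat ltnW.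
have h7 : k%:R <= i%:R :> R by rewrite ler_nat ltnW.
have h8 : 0 <= k%:R :> R by [].
have h9 := base_level_ge k44; have h10 := hk2 k kk2.
rewrite ij natrD -ij in xz; lra.
Qed.

Lemma site_threshold_le : exists K, forall k, (K <= k)%N ->
  site_threshold k + 2 * d%:R * k%:R <= base_level k.
Proof.
have [k2 hk2] := correction_le.
exists (k2 + 8 * d + 4)%N => k kK.
have [kk2 kd k4] : [/\ (k2 <= k)%N, (8 * d + 4 <= k)%N & (4 <= k)%N] by split; lia.
have kdR : 8 * d%:R + 4 <= k%:R :> R by rewrite -natrM -natrD ler_nat.
have [_ _ _ _ kk16] := square_facts k4.
have /andP[corr0 _] := @log_correction_le_ln R (k * k) (leq_trans (isT : (3 <= 16)%N) kk16).
have h9 := base_level_ge k4; have h10 := hk2 k kk2.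
have h : (8 * d%:R + 4) * k%:R <= (k * k)%:R :> R by rewrite natrM ler_wpM2r.
have h1 : (k * k)%:R / 2 <= (k * k)%:R * ln 2 :> R by exact: half_le_ln2.
have k0 : 0 <= k%:R :> R by [].
rewrite /site_threshold; lra.
Qed.

(** lnln t <= 2 ln k, so lnlnln t exceeds lnln k by at most ln 2; of the d + 1 terms lnln k, d come
    from the slope and one from the low maximum. *)
Lemma base_level_le k (t : R) : (4 <= k)%N -> t = 2 ^+ (k * k) ->
  base_level k <= d%:R * ln t - d.+1%:R * ln (ln (ln t)) +
    (d%:R * ln 6 + d.+2%:R).
Proof.
move=> k4 tE; have /andP[ln2l ln2u] := @ln2_bounds R.
have [_ _ _ _ kk16] := square_facts k4.
have lt : ln t = (k * k)%:R * ln 2 by rewrite tE exp2E expRK.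
have kR : 0 < k%:R :> R by rewrite ltr0n (leq_trans _ k4).
have p1 : 1 <= ln k%:R :> R.
  have k3 : (3 <= k.-1)%N by rewrite -ltnS prednK// (leq_trans _ k4).
  by have := @ln_succ_ge1 R _ k3; rewrite prednK// (leq_trans _ k4).
have lt1 : 1 < ln t.
  rewrite lt; apply: (@lt_le_trans _ _ (16 * 2^-1)); first by lra.
  by rewrite ler_pM ?(ler_nat R 16).
have llt0 : 0 < ln (ln t) by rewrite ln_gt0.
have llt : ln (ln t) <= 2 * ln k%:R.
  rewrite [leRHS]mulr_natl mulr2n -lnM ?posrE// ler_ln ?posrE ?mulr_gt0//; last first.
    exact: lt_trans lt1.
  by rewrite lt natrM ln2_le1// mulr_ge0.
have p0 : 0 < ln k%:R :> R by exact: lt_le_trans p1.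
have lllt : ln (ln (ln t)) <= ln 2 + ln (ln k%:R).
  by rewrite -lnM ?posrE// ler_ln ?posrE// mulr_gt0.
have llk : ln (ln k%:R) <= ln (ln k.+1%:R) :> R.
  have h : ln k%:R <= ln k.+1%:R :> R by rewrite ler_ln ?posrE ?ler_nat.
  by rewrite ler_ln ?posrE// (lt_le_trans p0).
have h7 : d.+1%:R * ln (ln (ln t)) <= d.+1%:R * (ln 2 + ln (ln k%:R)).
  by rewrite ler_wpM2l.
have h8 : d.+1%:R * ln 2 <= d.+1%:R :> R by rewrite ln2_le1.
have Lt : d%:R * ln t = d%:R * (k * k)%:R * ln 2 by rewrite lt mulrA.
rewrite Lt base_levelE//; rewrite -[d.+2%:R]natr1.
rewrite -[d.+1%:R]natr1 in h7 h8 *; lra.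
Qed.

Lemma growth_rate_liminf_le : exists C : R, forall A : R, exists2 t, A <= t &
  (growth_rate u t <= (d%:R * ln t - d.+1%:R * ln (ln (ln t)) + C)%:E)%E.
Proof.
have [k1 hk1] := sparse; have [k2 hk2] := inner_sites_le.
have [k3 hk3] := outer_sites_le; have [k4 hk4] := site_threshold_le.
(* The 2 pays twice for the flat spheres, in the choice of lam and in bounding S below by a linear
   function; d ln 5 is the sum over the lattice. *)
exists (d%:R * ln 6 + d.+2%:R + 2 + d%:R * ln 5) => A.
have [k] := low ((Num.truncn A).+1 + k1 + k2 + k3 + k4 + 4)%N.
move: (Num.truncn A).+1 (truncnS_gt A) => a /ltW Aa kK lowk.
have [ak kk1 kk2 kk3] : [/\ (a <= k)%N, (k1 <= k)%N, (k2 <= k)%N & (k3 <= k)%N].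
  by split; lia.
have [kk4 k44] : (k4 <= k)%N /\ (4 <= k)%N by split; lia.
have [lokk _ _ _ _] := square_facts k44.
have {hk1} spk := hk1 k kk1; have {hk2} inner := hk2 k kk2.
have {hk3} outer := hk3 k kk3; have {hk4} thr := hk4 k kk4.
pose t : R := 2 ^+ (k * k).
have t1 : 1 <= t by rewrite exprn_ege1// ler1n.
have t0 : 0 < t := lt_le_trans ltr01 t1.
exists t.
  rewrite (le_trans Aa)// (@le_trans _ _ k%:R)// ?ler_nat// /t -natrX ler_nat.
  by rewrite (leq_trans (ltnW (ltn_expl k (ltnSn 1))))// leq_exp2l// -lokk leq_addl.
set p : R := ln k%:R.
have kR : 0 < k%:R :> R by rewrite ltr0n (leq_trans _ k44).
have p1 : 1 <= p.
  have k3' : (3 <= k.-1)%N by rewrite -ltnS prednK// (leq_trans _ k44).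
  by have := @ln_succ_ge1 R _ k3'; rewrite prednK// (leq_trans _ k44).
have p0 : 0 <= p := le_trans ler01 p1.
have ep : expR p = k%:R by rewrite /p lnK// posrE.
set n := (2 ^ (k * k.+1))%N in spk lowk outer.
set theta := site_threshold k in spk thr.
set H := high_sites xi n theta in spk.
pose S := profile xi n theta p.
have sl : slope k = p / (2 * t) by [].
have sl0 : 0 <= slope k by rewrite sl divr_ge0// mulr_ge0// ltW.
(* The total loss from flat spheres: slope times t 2^-k is ln k / 2^(k+1). *)
have slH : slope k * H%:R <= 1.
  have HR : H%:R <= 2 ^+ (k * k.-1) :> R by rewrite -natrX ler_nat.
  apply: (le_trans (ler_wpM2l sl0 HR)).
  rewrite sl /t -lokk exprD mulrAC ler_pdivrMr; last by rewrite !mulr_gt0 ?exprn_gt0.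
  rewrite mul1r mulrCA [leLHS]mulrC ler_wpM2l ?exprn_ge0//.
  apply: (@le_trans _ _ (2 ^+ k)); last by rewrite ler_peMl ?exprn_ge0// ler1n.
  apply: (@le_trans _ _ k%:R); first by rewrite ltW// ln_sublinear.
  by rewrite -natrX ler_nat ltnW// ltn_expl.
have Sge r : slope k * r%:R - 1 <= S r / (2 * t).
  have := profile_ge xi n theta p0 r; rewrite -/H -/S => h.
  have h2 : p * (r%:R - H%:R) / (2 * t) <= S r / (2 * t).
    by rewrite ler_wpM2r// invr_ge0 mulr_ge0// ltW.
  by apply: le_trans h2; rewrite [leRHS]mulrAC -sl mulrBr lerD2l lerN2.
have S0 r : 0 <= S r / (2 * t).
  by rewrite divr_ge0 ?profile_ge0// mulr_ge0// ltW.
(* On a sphere where S is flat the jump term vanishes and the inner or annulus bound applies; on the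
   other spheres up to radius n, xi is below the threshold; beyond n the slope term pays for
   everything. *)
have cond z : xi z + 2 * d%:R * (expR (S (norm1 z) - S (norm1 z).-1) - 1) <=
    base_level k + 1 + S (norm1 z) / (2 * t).
  have Sz := Sge (norm1 z); have Sz0 := S0 (norm1 z).
  have dstep : 2 * d%:R * (expR (S (norm1 z) - S (norm1 z).-1) - 1) <= 2 * d%:R * k%:R.
    rewrite ler_wpM2l ?mulr_ge0// lerBlDr.
    apply: (@le_trans _ _ k%:R); last by rewrite lerDl.
    by rewrite -ep ler_expR; exact: profile_step.
  have [zn|nz] := leqP (norm1 z) n.
    have [hz|] := boolP ((norm1 z == 0)%N || high_shell xi n theta (norm1 z)).
      rewrite /S (profile_step_high _ hz) expR0 subrr mulr0 addr0 -/S.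
      have [zlo|loz] := leqP (norm1 z) (2 ^ (k * k.-1)).
        by have := inner z zlo; lra.
      by have := lowk z; rewrite loz zn => /(_ isT); lra.
    rewrite negb_or => /andP[_ /existsPn nh].
    have [b zb] := box_point_surj zn.
    have := nh b; rewrite -zb eqxx/= -leNgt => zth.
    by lra.
  by have := outer z nz; lra.
have h := @pam_le R d xi u xi0 solu (upper_envelope_sublinear xi_upper) t
  (base_level k + 1) S t0 (profile0 _ _ _ _) (profile_nd xi n theta p0) cond.
have h' y : u t y <= expR ((base_level k + 2) * t - p / 2 * (norm1 y)%:R).
  apply: (le_trans (h y)); rewrite ler_expR.
  have := Sge (norm1 y); rewrite sl -(ler_pM2r t0).
  have -> : (p / (2 * t) * (norm1 y)%:R - 1) * t = p / 2 * (norm1 y)%:R - t.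
    by field; rewrite gt_eqF.
  have -> : S (norm1 y) / (2 * t) * t = S (norm1 y) / 2 by field; rewrite gt_eqF.
  by lra.
have [u0 _ _] := solu.
have a0 : 0 < p / 2 by rewrite divr_gt0// (lt_le_trans ltr01).
apply: (le_trans (@growth_rate_le R d u t _ _ t0 a0 (fun y => u0 t y t0) h')).
have lev := base_level_le k44 (erefl t); rewrite lee_fin.
have h5 : d%:R * ln (1 + 2 / (p / 2)) / t <= d%:R * ln 5.
  have b1 : 0 < 1 + 2 / (p / 2) by rewrite addr_gt0// divr_gt0.
  have b2 : ln (1 + 2 / (p / 2)) <= ln 5.
    rewrite ler_ln ?posrE//.
    have : 2 / (p / 2) <= 4 by rewrite ler_pdivrMr//; lra.
    by lra.
  have b3 : 0 <= d%:R * ln 5 :> R by rewrite mulr_ge0// ln_ge0// ler1n.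
  rewrite ler_pdivrMr//; apply: (@le_trans _ _ (d%:R * ln 5)).
    by rewrite ler_wpM2l.
  by rewrite ler_peMr.
by lra.
Qed.

End growth_liminf_upper_bound.

(** * Almost sure bounds on annuli *)

Section exponential_annuli.
Context (R : realType) (disp : measure_display) (T : measurableType disp)
  (P : probability T R) (d : nat) (xi : 'rV[int]_d -> {RV P >-> R}).
Hypothesis d1 : (1 <= d)%N.
Hypothesis xi_indep : mutually_independent xi.
Hypothesis xi_exp : forall z, standard_exponential (xi z).

Definition annulus k : {fset 'rV[int]_d} :=
  [fset z in [seq box_point b | b : @box_index d (2 ^ (k * k.+1))] |
     (2 ^ (k * k.-1) < norm1 z <= 2 ^ (k * k.+1))%N]%fset.

Lemma in_annulus k z :
  (z \in annulus k) = (2 ^ (k * k.-1) < norm1 z <= 2 ^ (k * k.+1))%N.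
Proof.
rewrite !inE; apply/andP/idP => [[]//|zk]; split => //.
have /andP[_ zk'] := zk; have [b ->] := box_point_surj zk'.
exact: codom_f.
Qed.

(** The outer exponent k(k + 1) of one annulus is the inner exponent of the next. *)
Lemma annulus_disjoint k l z : z \in annulus k -> z \in annulus l -> k = l.
Proof.
have h m n : z \in annulus m -> z \in annulus n -> ~ (m < n)%N.
  rewrite !in_annulus => /andP[_ zm] /andP[zn _] mn.
  have := leq_trans zn zm; rewrite ltn_exp2l// ltnNge => /negP; apply.
  by rewrite mulnC leq_mul//; case: n mn zn.
move=> zk zl; have := h _ _ zk zl; have := h _ _ zl zk; lia.
Qed.

Lemma slope_bounds k : (4 <= k)%N ->
  0 < (slope k : R) <= 1 /\ ln 2 <= @base_level R d k.
Proof.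
move=> k4; have k3 : (3 <= k.-1)%N by rewrite -ltnS prednK// (leq_trans _ k4).
have kR : 0 < k%:R :> R by rewrite ltr0n (leq_trans _ k4).
have k1 : 1 <= k%:R :> R by rewrite ler1n (leq_trans _ k4).
have l1 : 1 <= ln k%:R :> R.
  by have := @ln_succ_ge1 R _ k3; rewrite prednK// (leq_trans _ k4).
have l1' : 1 <= ln k.+1%:R :> R by apply: ln_succ_ge1; rewrite (leq_trans _ k4).
have lk : ln k%:R <= k%:R :> R by rewrite ltW// ln_sublinear.
have lk' : ln k.+1%:R <= k%:R :> R.
  by rewrite -nat1r; apply: le_ln1Dx; rewrite (lt_le_trans (ltrN10 R)).
have kk : k%:R * k%:R <= 2 ^+ (k * k) :> R.
  by rewrite -natrM -natrX ler_nat ltnW// ltn_expl.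
have t0 : 0 < 2 * 2 ^+ (k * k) :> R by rewrite mulr_gt0// exprn_gt0.
have s0 : 0 < slope k :> R by rewrite divr_gt0// (lt_le_trans ltr01).
have lkk : ln k%:R * ln k.+1%:R <= 2 ^+ (k * k) :> R.
  by apply: le_trans kk; rewrite ler_pM// (le_trans ler01).
split.
  by rewrite s0/= /slope ler_pdivrMr// mul1r; nra.
have l3 : ln k.+1%:R <= 3 / slope k :> R.
  rewrite ler_pdivlMr// /slope mulrA ler_pdivrMr//; nra.
have h : ln (ln k.+1%:R) <= ln (3 / slope k) :> R.
  by rewrite ler_ln ?posrE// ?divr_gt0// (lt_le_trans ltr01).
have h0 : 0 <= ln (ln k.+1%:R) :> R by rewrite ln_ge0.
have : ln (3 / slope k) <= d%:R * ln (3 / slope k) :> R.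
  by rewrite ler_peMl ?ler1n// (le_trans h0).
rewrite /base_level; lra.
Qed.

Lemma field_annuli_low_ae : {ae P, forall w, forall m, exists2 k, (m <= k)%N &
  forall z, (2 ^ (k * k.-1) < norm1 z <= 2 ^ (k * k.+1))%N ->
  xi z w <= @base_level R d k + slope k * (norm1 z)%:R}.
Proof.
(* For k < 4 the logarithms may be too small; the dummy values 1 and ln 2 satisfy the bounds that
   [field_blocks_low_ae] asks for at every k. *)
pose a k : R := if (4 <= k)%N then slope k else 1.
pose lam k : R := if (4 <= k)%N then @base_level R d k else ln 2.
have := @field_blocks_low_ae R disp T P d xi xi_indep xi_exp annulus a lam 4
  annulus_disjoint.
have a01 k : 0 < a k <= 1.
  by rewrite /a; case: ifPn => [/slope_bounds[]//|_]; rewrite ltr01 lexx.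
have lamE k : (4 <= k)%N -> lam k = d%:R * ln (3 / a k) + ln 2 - ln (ln k.+1%:R).
  by rewrite /lam /a => ->.
have lam2 k : ln 2 <= lam k.
  by rewrite /lam; case: ifPn => [/slope_bounds[]//|_].
move=> /(_ a01 lamE lam2 isT); apply: filterS => w H m.
have [k] := H (maxn m 4); rewrite geq_max => /andP[mk k4] Hk.
exists k => // z zk; have := Hk z; rewrite in_annulus zk => /(_ isT).
by rewrite /lam /a k4.
Qed.

(** By Markov, the probability is at most 2^(2d + (d + 1) k - k^2 / 2), which is below 2^-(k+1) once
    k >= 8d + 8. *)
Lemma field_sparse_ae : {ae P, forall w, exists k0, forall k, (k0 <= k)%N ->
  (high_sites (xi^~ w) (2 ^ (k * k.+1)) (@site_threshold R d k) <=
   2 ^ (k * k.-1))%N}.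
Proof.
pose E k (b : @box_index d (2 ^ (k * k.+1))) :=
  [set w | @site_threshold R d k < xi (box_point b) w].
have mE k b : measurable (@E k b) by exact: measurable_field_gt.
pose A k := [set w | (2 ^ (k * k.-1) <= count_in (@E k) w)%N].
have : {ae P, forall w, exists k1, forall k, (k1 <= k)%N -> ~ A k w}.
  apply: (@ae_eventually_notin _ _ _ P A (fun k => expR (- (k%:R * ln 2))) (8 * d + 8)).
  - by move=> k; exact: measurable_count_ge.
  - by move=> k; exact: expR_ge0.
  move=> k kd; have k4 : (4 <= k)%N by lia.
  have [lokk hikk _ _ _] := square_facts k4.
  have kdR : 8 * d%:R + 8 <= k%:R :> R by rewrite -natrM -natrD ler_nat.
  have lo0 : (0 < 2 ^ (k * k.-1))%N by rewrite expn_gt0.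
  have := @probability_count_ge _ _ _ P _ (@E k) (mE k) (expR (- @site_threshold R d k)) _ lo0.
  move=> /(_ (fun b => probability_field_gt xi_exp (box_point b) (@site_threshold R d k))).
  move=> /le_trans; apply; rewrite lee_fin.
  have -> : expR (- (k%:R * ln 2)) - expR (- (k.+1%:R * ln 2)) =
      expR (- (k.+1%:R * ln 2)) :> R.
    rewrite !expRN -!exp2E exprS; field; rewrite expf_neq0//.
  apply: (@le_trans _ _ (4 ^+ d * expR (d%:R * (k * k.+1)%:R * ln 2) *
      expR (- @site_threshold R d k) / (2 ^ (k * k.-1))%:R)).
    rewrite ler_wpM2r ?invr_ge0// ler_wpM2r ?expR_ge0//.
    exact: card_box_index_le.
  have -> : 4 = 2 ^+ 2 :> R by rewrite -natrX.
  rewrite exp2XE natrX [2 ^+ (k * k.-1)]exp2E -expRN -!expRD ler_expR.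
  have ln20 : 0 <= ln 2 :> R by rewrite ln_ge0// ler1n.
  have -> : (k * k.+1)%:R = (k * k)%:R + k%:R :> R by rewrite -hikk natrD.
  have -> : (k * k.-1)%:R = (k * k)%:R - k%:R :> R by rewrite -lokk natrD addrK.
  rewrite /site_threshold.
  have h : (8 * d%:R + 8) * k%:R <= (k * k)%:R :> R by rewrite natrM ler_wpM2r.
  have kR : 1 <= k%:R :> R by rewrite ler1n (leq_trans _ k4).
  have dR : 1 <= d%:R :> R by rewrite ler1n.
  have q : 2 * d%:R + d%:R * ((k * k)%:R + k%:R) - (d%:R - 2^-1) * (k * k)%:R -
      ((k * k)%:R - k%:R) + k.+1%:R <= 0 :> R.
    rewrite -[k.+1%:R]natr1; nra.
  have := mulr_le0_ge0 q ln20; lra.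
apply: filterS => w [k1 hk1]; exists k1 => k kk.
have := hk1 k kk; rewrite /A/= => /negP; rewrite -ltnNge => /ltnW.
by congr (_ <= _)%N; apply: eq_card => b; rewrite !unfold_in/= asboolb.
Qed.

End exponential_annuli.

(** * From bounds up to constants to the normalised limits *)

Section normalized_growth.
Context {R : realType}.
Implicit Types (g : \bar R) (a l c : R).

Lemma normalized_le g a l c : 0 < l ->
  (((g - a%:E) * (l^-1)%:E <= c%:E) = (g <= (c * l + a)%:E))%E.
Proof. by move=> l0; rewrite lee_pdivrMr// leeBlDr// -EFinM -EFinD. Qed.

Lemma normalized_ge g a l c : 0 < l ->
  ((c%:E <= (g - a%:E) * (l^-1)%:E) = ((c * l + a)%:E <= g))%E.
Proof. by move=> l0; rewrite lee_pdivlMr// leeBrDr// -EFinM -EFinD. Qed.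

Variables (g : R -> \bar R) (D : R).

Lemma limsup_normalized (C1 C2 : R) : 0 <= D ->
  (\forall t \near +oo,
    (g t <= (D * ln t + ln (ln t) + 2 * ln (ln (ln t)) + C1)%:E)%E) ->
  (forall A : R, exists2 t, A <= t &
    ((D * ln t + ln (ln t) - D * ln (ln (ln t)) - C2)%:E <= g t)%E) ->
  limf_esup (fun t : R => ((g t - (D * ln t)%:E) * ((ln (ln t))^-1)%:E)%E)
    (+oo%R : set_system R) = 1%E.
Proof.
move=> D0 up low; apply: limf_esup_pinfty => [e e0|e A e0].
  have e4 : 0 < e / 4 by rewrite divr_gt0.
  near=> t.
  have l2 : Num.max 1 (C1 / (e / 2)) <= ln (ln t) by near: t; exact: near_lnln_ge.
  have l3 : ln (ln (ln t)) <= e / 4 * ln (ln t).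
    near: t; apply: (@near_ln R (fun x => ln (ln x) <= e / 4 * ln x)).
    by apply: (@near_ln R (fun x => ln x <= e / 4 * x)); exact: near_ln_le.
  move: l2; rewrite ge_max => /andP[l21]; rewrite ler_pdivrMr ?divr_gt0// => l2C.
  rewrite normalized_le; last exact: lt_le_trans l21.
  have : (g t <= (D * ln t + ln (ln t) + 2 * ln (ln (ln t)) + C1)%:E)%E by near: t.
  by move=> /le_trans; apply; rewrite lee_fin; lra.
have D1 : 0 < D + 1 by rewrite ltr_wpDl.
(* Chosen so that D lnlnln t is at most (e / 2) lnln t; the other half of e absorbs C2. *)
have e4 : 0 < e / 2 / (D + 1) by rewrite !divr_gt0.
have [M [_ MQ]] : \forall t \near +oo,
    Num.max 1 (C2 / (e / 2)) <= ln (ln t) /\ ln (ln (ln t)) <= e / 2 / (D + 1) * ln (ln t).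
  near=> t; split; first by near: t; exact: near_lnln_ge.
  near: t; apply: (@near_ln R (fun x => ln (ln x) <= e / 2 / (D + 1) * ln x)).
  by apply: (@near_ln R (fun x => ln x <= e / 2 / (D + 1) * x)); exact: near_ln_le.
have [t] := low (Num.max A (M + 1)); rewrite ge_max => /andP[At Mt] gt.
exists t => //; have [] := MQ t; first by rewrite (lt_le_trans _ Mt)// ltrDl.
rewrite ge_max => /andP[l21]; rewrite ler_pdivrMr ?divr_gt0// => l2C l3.
have l20 : 0 < ln (ln t) := lt_le_trans ltr01 l21.
rewrite normalized_ge//; apply: le_trans gt; rewrite lee_fin.
have l30 : 0 <= ln (ln (ln t)) by rewrite ln_ge0.
have : (D + 1) * ln (ln (ln t)) <= e / 2 * ln (ln t).
  apply: le_trans (ler_wpM2l (ltW D1) l3) _.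
  by rewrite mulrA mulrCA divff ?mulr1// gt_eqF.
lra.
Unshelve. all: by end_near. Qed.

Lemma liminf_normalized (b C1 C2 : R) :
  (\forall t \near +oo,
    ((D * ln t - b * ln (ln (ln t)) - C1)%:E <= g t)%E) ->
  (forall A : R, exists2 t, A <= t &
    (g t <= (D * ln t - b * ln (ln (ln t)) + C2)%:E)%E) ->
  limf_einf (fun t : R => ((g t - (D * ln t)%:E) * ((ln (ln (ln t)))^-1)%:E)%E)
    (+oo%R : set_system R) = (- b)%:E.
Proof.
move=> low up; apply: limf_einf_pinfty => [e e0|e A e0].
  near=> t.
  have l3 : Num.max 1 (C1 / e) <= ln (ln (ln t)) by near: t; exact: near_lnlnln_ge.
  move: l3; rewrite ge_max => /andP[l31]; rewrite ler_pdivrMr// => l3C.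
  rewrite normalized_ge; last exact: lt_le_trans l31.
  have : ((D * ln t - b * ln (ln (ln t)) - C1)%:E <= g t)%E by near: t.
  by apply: le_trans; rewrite lee_fin; lra.
have [M [_ MQ]] := @near_lnlnln_ge R (Num.max 1 (C2 / e)).
have [t] := up (Num.max A (M + 1)); rewrite ge_max => /andP[At Mt] gt.
exists t => //; have := MQ t; rewrite (lt_le_trans _ Mt) ?ltrDl// => /(_ isT).
rewrite ge_max => /andP[l31]; rewrite ler_pdivrMr// => l3C.
rewrite normalized_le; last exact: lt_le_trans l31.
by apply: (le_trans gt); rewrite lee_fin; lra.
Unshelve. all: by end_near. Qed.

End normalized_growth.

Theorem theorem2 (R : realType) (disp : measure_display)
    (T : measurableType disp) (P : probability T R)
    (d : nat) (d_ge1 : (1 <= d)%N)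
    (xi : 'rV[int]_d -> {RV P >-> R})
    (xi_indep : mutually_independent xi)
    (xi_exp : forall z, standard_exponential (xi z))
    (u : T -> R -> 'rV[int]_d -> R)
    (u_sol : {ae P, forall w, nonneg_pam_solution (fun z => xi z w) (u w)}) :
  {ae P, forall w,
    limf_esup (fun t : R =>
      (growth_rate (u w) t - (d%:R * ln t)%:E) * ((ln (ln t))^-1)%:E)%E
      (+oo%R : set_system R) = 1%E /\
    limf_einf (fun t : R =>
      (growth_rate (u w) t - (d%:R * ln t)%:E) * ((ln (ln (ln t)))^-1)%:E)%E
      (+oo%R : set_system R) = (- (d.+1)%:R%:E)%E}.
Proof.
(* Seven almost sure events are intersected; the rest is deterministic for a fixed realisation. *)
move: u_sol; apply: filter_app.
move: (field_ge0_ae xi_exp); apply: filter_app.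
move: (field_upper_ae xi_exp); apply: filter_app.
move: (field_cube_high_ae xi_indep xi_exp d_ge1); apply: filter_app.
move: (field_cube_low_ae xi_indep xi_exp d_ge1); apply: filter_app.
move: (field_annuli_low_ae d_ge1 xi_indep xi_exp); apply: filter_app.
move: (field_sparse_ae d_ge1 xi_exp); apply: filterS.
move=> w sparse annuli low high upper xi0 sol.
have [C1 limsup_le] := growth_rate_limsup_le xi0 sol upper.
have [C2 limsup_ge] := growth_rate_limsup_ge d_ge1 xi0 sol high.
have [C3 liminf_ge] := growth_rate_liminf_ge d_ge1 xi0 sol low.
have [C4 liminf_le] := growth_rate_liminf_le d_ge1 xi0 sol upper sparse annuli.
split; first exact: limsup_normalized limsup_le limsup_ge.
by rewrite -EFinN; exact: liminf_normalized liminf_ge liminf_le.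
Qed.
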